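(* (i) For $n\ge2$, every nonempty shell of $\mathbb Z^n$ and of $\mathrm{Sh}(\mathbb Z^n)$ is a spherical $3$-design. (ii) The following shells are spherical $3\tfrac12$-designs: every nonempty shell of $\mathbb Z^2$ and of $\mathrm{Sh}(\mathbb Z^2)$; $(\mathbb Z^{16})_m$ for $m=2\cdot4^a$, $a\ge0$; $\mathrm{Sh}(\mathbb Z^{16})_m$ for $m=2\cdot4^a$, $a\ge1$; $\mathrm{Sh}(\mathbb Z^{40})_{24}$. (iii) The following shells are spherical $5$-designs: $(\mathbb Z^4)_m$ for $m=2a$, $a\ge1$; $(\mathbb Z^7)_m$ for $m=4^a(8b+3)$, $a,b\ge0$; $\mathrm{Sh}(\mathbb Z^{16})_m$ for $m=4a+2$, $a\ge1$.
   Context: $\mathbb Z^n\subset\mathbb R^n$ is the cubic lattice; its shadow is $\mathrm{Sh}(\mathbb Z^n)=(\mathbb Z+\tfrac12)^n$. For $A\subset\mathbb R^n$, the shell of norm $m$ is $A_m=\{x\in A:\langle x,x\rangle=m\}$. Spherical designs (all sets here are antipodal, $X=-X$): for a nonempty finite antipodal $X$ on a sphere centred at $0$ and $j\ge1$, condition $(C_{2j})$ means $\sum_{x\in X}P(x)=0$ for every homogeneous harmonic polynomial $P$ of degree $2j$ on $\mathbb R^n$. $X$ is a spherical $t$-design ($t$ a positive integer) iff $(C_{2j})$ holds for all $2\le 2j\le t$. $X$ is a spherical $(2s+1+\tfrac12)$-design iff $(C_{2j})$ holds for all $2\le2j\le2s$ and for $2j=2s+4$; thus a $3\tfrac12$-design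 satisfies $(C_2)$ and $(C_6)$. *)

(* Defs.v *)
From HB Require Import structures.
From mathcomp Require Import all_boot all_order all_algebra.
From mathcomp Require Import reals.
From mathcomp Require Import mpoly.

Set Implicit Arguments.
Unset Strict Implicit.
Unset Printing Implicit Defensive.

Import Order.TTheory GRing.Theory Num.Theory.
Local Open Scope ring_scope.

Section Defs.
Variable R : realType.

Definition sqnorm n (x : 'rV[R]_n) : R := \sum_(i < n) x 0 i ^+ 2.

Definition evalp n (P : {mpoly R[n]}) (x : 'rV[R]_n) : R :=
  P.@[fun i => x 0 i].

Definition laplacian n (P : {mpoly R[n]}) : {mpoly R[n]} :=
  \sum_(i < n) mderiv i (mderiv i P).

Definition harmonic n (P : {mpoly R[n]}) : bool := laplacian P == 0.

(* Condition (C_{2j}) for a finite set X (given as a duplicate-free list):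
   sum of P over X vanishes for every homogeneous harmonic P of degree 2j. *)
Definition cond_C n (X : seq 'rV[R]_n) (k : nat) : Prop :=
  forall P : {mpoly R[n]}, P \is k.-homog -> harmonic P ->
    \sum_(x <- X) evalp P x = 0.

Definition sph_design n (X : seq 'rV[R]_n) (t : nat) : Prop :=
  X != [::] /\ forall j : nat, (1 <= j)%N -> (j.*2 <= t)%N -> cond_C X j.*2.

(* Spherical (2s+1+1/2)-design: (C_2j) for 2 <= 2j <= 2s, and (C_{2s+4}). *)
Definition sph_design_half n (X : seq 'rV[R]_n) (s : nat) : Prop :=
  X != [::] /\
  (forall j : nat, (1 <= j)%N -> (j <= s)%N -> cond_C X j.*2) /\
  cond_C X (2 * s + 4)%N.

(* Bound on coordinates of a point of norm m: |x_i| <= sqrt m <= B. *)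
Definition box_bound (m : R) : nat := (Num.truncn m).+1.

(* The shell (Z^n)_m: all integer vectors x with <x,x> = m.
   Integer vectors in the box [-B, B]^n are enumerated injectively via
   k : {ffun 'I_n -> 'I_(2B+1)}, x_i = k_i - B; the box contains the shell. *)
Definition shellZ n (m : R) : seq 'rV[R]_n :=
  let B := box_bound m in
  [seq x <- [seq \row_(i < n) ((k i)%:R - B%:R) | k : {ffun 'I_n -> 'I_(B.*2.+1)}]
     | sqnorm x == m].

(* The shell Sh(Z^n)_m of the shadow (Z + 1/2)^n: x_i = k_i - B - 1/2 with
   k_i in {0, ..., 2B+1}, i.e. x_i ranges over -B-1/2, ..., B+1/2. *)
Definition shellSh n (m : R) : seq 'rV[R]_n :=
  let B := box_bound m in
  [seq x <- [seq \row_(i < n) ((k i)%:R - B%:R - 2^-1)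
              | k : {ffun 'I_n -> 'I_(B.*2.+2)}]
     | sqnorm x == m].

End Defs.

(* Main.v *)
Require Import Defs.
From HB Require Import structures.
From mathcomp Require Import all_boot all_order all_algebra.
From mathcomp Require Import boolp reals.
From mathcomp Require Import mpoly.
From mathcomp Require Import ring zify.

Set Implicit Arguments.
Unset Strict Implicit.
Unset Printing Implicit Defensive.

Import Order.TTheory GRing.Theory Num.Theory.
Local Open Scope ring_scope.

(* Put [A] and [B] for the sums of [x ^ (y ^ 2)] over the even and over the odd
   integers [y], so that [A ^ n] and [B ^ n] count the vectors of the doubled
   lattice and of its doubled shadow by their norm. The theta series of a
   harmonic [P] of degree 2, 4 or 6 is computed by Gaussian integration by
   parts: the Laplacian takes care of the Gaussian part, and what remains is a
   multiple of the fourth or sixth cumulant of one coordinate, a differential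
   polynomial in [A] or [B].

   Rotating the plane by 45 degrees gives
   [A(x)^2 = A(x^2)^2 + B(x^2)^2] and [B(x)^2 = 2 A(x^2) B(x^2)]. A relation
   between a series at [x] and at [x^2] determines the series, and this turns
   the two formulas into product formulas for the cumulants, symmetric in [A]
   and [B]: the theta series of degree 4 of [Z^n] and of its shadow are
   multiples of [A^n B^4 (A^4 - B^4)] and of [B^n A^4 (B^4 - A^4)].

   With [S = A^4 + B^4] and [C = A^2 B^2], the values of [A^4], [B^4] and
   [A^4 - B^4] at [x] are those of [S + 2 C], [4 C] and [S - 2 C] at [x^2]. As
   [A] lives on exponents 0 mod 4 and [B] on exponents 1 mod 8, [C] lives on
   exponents 2 mod 4, and every such substitution separates the even and the odd
   powers of [C]. A few of them show that the required coefficients vanish.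
   Shells are nonempty by Lagrange's theorem. *)

(** * Formal power series *)

Record fps (R : Type) := Fps { fps_coef :> nat -> R }.

HB.instance Definition _ R := gen_eqMixin (fps R).
HB.instance Definition _ R := gen_choiceMixin (fps R).

Lemma fpsP R (s t : fps R) : s =1 t -> s = t.
Proof. by case: s t => [s] [t] /= /funext ->. Qed.

Section FpsRing.
Context {R : comNzRingType}.
Implicit Types (s t u : fps R) (p q : {poly R}) (c : R).

Definition fps_zero : fps R := Fps (fun=> 0).
Definition fps_one : fps R := Fps (fun N => (N == 0%N)%:R).
Definition fps_add s t := Fps (fun N => s N + t N).
Definition fps_opp s := Fps (fun N => - s N).
Definition fps_mul s t := Fps (fun N => \sum_(i < N.+1) s i * t (N - i)%N).
Definition fps_scale c s := Fps (fun N => c * s N).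

(* Truncation reduces multiplicative identities to the same identities for
   polynomials. *)
Definition approximates N p s := forall i, (i <= N)%N -> p`_i = s i.

Definition fps_trunc N s : {poly R} := \poly_(i < N.+1) s i.

Lemma approximates_trunc N s : approximates N (fps_trunc N s) s.
Proof. by move=> i leiN; rewrite coef_poly ltnS leiN. Qed.

Lemma approximatesM N p q s t : approximates N p s -> approximates N q t ->
  approximates N (p * q) (fps_mul s t).
Proof.
move=> ps qt i leiN; rewrite coefM; apply: eq_bigr => j _.
by rewrite ps ?qt //; move: (ltn_ord j); lia.
Qed.

Lemma approximates_inj s t : (forall N, exists2 p, approximates N p s & approximates N p t) ->
  s = t.
Proof.
by move=> st; apply/fpsP => N; have [p ps pt] := st N; rewrite -ps // pt.
Qed.

Lemma fps_addA : associative fps_add.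
Proof. by move=> s t u; apply/fpsP => N /=; rewrite addrA. Qed.

Lemma fps_addC : commutative fps_add.
Proof. by move=> s t; apply/fpsP => N /=; rewrite addrC. Qed.

Lemma fps_add0r : left_id fps_zero fps_add.
Proof. by move=> s; apply/fpsP => N /=; rewrite add0r. Qed.

Lemma fps_addNr : left_inverse fps_zero fps_opp fps_add.
Proof. by move=> s; apply/fpsP => N /=; rewrite addNr. Qed.

HB.instance Definition _ :=
  GRing.isZmodule.Build (fps R) fps_addA fps_addC fps_add0r fps_addNr.

Lemma fps_mulA : associative fps_mul.
Proof.
move=> s t u; apply: approximates_inj => N.
exists (fps_trunc N s * fps_trunc N t * fps_trunc N u); last first.
  by do 2?[apply: approximatesM]; apply: approximates_trunc.
by rewrite -mulrA; do 2?[apply: approximatesM]; apply: approximates_trunc.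
Qed.

Lemma fps_mulC : commutative fps_mul.
Proof.
move=> s t; apply: approximates_inj => N; exists (fps_trunc N s * fps_trunc N t).
  by apply: approximatesM; apply: approximates_trunc.
by rewrite mulrC; apply: approximatesM; apply: approximates_trunc.
Qed.

Lemma fps_mul1r : left_id fps_one fps_mul.
Proof.
move=> s; apply/fpsP => N /=.
by rewrite big_ord_recl big1 /= ?subn0 ?mul1r ?addr0 // => i _; rewrite mul0r.
Qed.

Lemma fps_mulDl : left_distributive fps_mul fps_add.
Proof.
by move=> s t u; apply/fpsP => N /=; rewrite -big_split; apply: eq_bigr => i _; rewrite mulrDl.
Qed.

Lemma fps_one_neq0 : fps_one != fps_zero.
Proof. by apply/eqP => /(congr1 (fun s : fps R => s 0%N)) /= /eqP; rewrite oner_eq0. Qed.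

HB.instance Definition _ := GRing.Zmodule_isComNzRing.Build (fps R)
  fps_mulA fps_mulC fps_mul1r fps_mulDl fps_one_neq0.

Lemma fps_scaleA c d s : fps_scale c (fps_scale d s) = fps_scale (c * d) s.
Proof. by apply/fpsP => N /=; rewrite mulrA. Qed.

Lemma fps_scale1r : left_id 1 fps_scale.
Proof. by move=> s; apply/fpsP => N /=; rewrite mul1r. Qed.

Lemma fps_scaleDr : right_distributive fps_scale +%R.
Proof. by move=> c s t; apply/fpsP => N /=; rewrite mulrDr. Qed.

Lemma fps_scaleDl s : {morph fps_scale^~ s : c d / c + d}.
Proof. by move=> c d; apply/fpsP => N /=; rewrite mulrDl. Qed.

HB.instance Definition _ := GRing.Zmodule_isLmodule.Build R (fps R)
  fps_scaleA fps_scale1r fps_scaleDr fps_scaleDl.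

Lemma fps_scaleAl c s t : c *: (s * t) = c *: s * t.
Proof.
by apply/fpsP => N /=; rewrite mulr_sumr; apply: eq_bigr => i _; rewrite mulrA.
Qed.

HB.instance Definition _ := GRing.Lmodule_isLalgebra.Build R (fps R) fps_scaleAl.
HB.instance Definition _ := GRing.Lalgebra_isComAlgebra.Build R (fps R).

Lemma fpsD s t N : (s + t) N = s N + t N. Proof. by []. Qed.
Lemma fpsN s N : (- s) N = - s N. Proof. by []. Qed.
Lemma fps0 N : (0 : fps R) N = 0. Proof. by []. Qed.
Lemma fps1 N : (1 : fps R) N = (N == 0%N)%:R. Proof. by []. Qed.
Lemma fpsZ c s N : (c *: s) N = c * s N. Proof. by []. Qed.
Lemma fpsM s t N : (s * t) N = \sum_(i < N.+1) s i * t (N - i)%N. Proof. by []. Qed.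

Lemma fps_sum I (r : seq I) (P : pred I) (F : I -> fps R) N :
  (\sum_(i <- r | P i) F i) N = \sum_(i <- r | P i) F i N.
Proof. by elim/big_rec2: _ => [|i x y _ <-]. Qed.

Lemma fpsMn s k N : (s *+ k) N = s N *+ k.
Proof. by elim: k => [|k IH]; rewrite ?mulr0n // !mulrS fpsD IH. Qed.

Lemma fps_natM k s N : (k%:R * s) N = k%:R * s N.
Proof. by rewrite !mulr_natl fpsMn. Qed.

Lemma fpsM0 s t : (s * t) 0 = s 0 * t 0.
Proof. by rewrite fpsM big_ord1. Qed.

Lemma fpsX0 s k : (s ^+ k) 0 = s 0 ^+ k.
Proof. by elim: k => [|k IH]; rewrite ?fps1 // !exprS fpsM0 IH. Qed.

Lemma approximates_prod (I : finType) N (p : I -> {poly R}) (s : I -> fps R) :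
  (forall i, approximates N (p i) (s i)) -> approximates N (\prod_i p i) (\prod_i s i).
Proof.
move=> ps; elim/big_rec2: _ => [i _|i t q _ qt]; first by rewrite coef1 fps1.
exact: approximatesM.
Qed.

(** * The substitution [x -> x ^ 2], the derivation [x d/dx], lowest terms *)

Definition dil s : fps R := Fps (fun N => if odd N then 0 else s N./2).

Lemma fps_dil s N : dil s N = if odd N then 0 else s N./2.
Proof. by []. Qed.

Lemma fps_dil_double s N : dil s N.*2 = s N.
Proof. by rewrite fps_dil odd_double doubleK. Qed.

Lemma approximates_dil N p s : approximates N p s -> approximates N (p \Po 'X^2) (dil s).
Proof.
move=> ps i leiN; rewrite coef_comp_poly_Xn // dvdn2 divn2 fps_dil.
by case: odd => //; apply: ps; lia.
Qed.

Lemma dil_is_zmod_morphism : zmod_morphism dil.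
Proof. by move=> s t; apply/fpsP => N /=; case: ifP; rewrite ?subr0. Qed.

Lemma dil_is_monoid_morphism : monoid_morphism dil.
Proof.
split=> [|s t]; first by apply/fpsP => -[|[|N]] //=; case: ifP.
apply: approximates_inj => N; exists ((fps_trunc N s * fps_trunc N t) \Po 'X^2).
  by apply: approximates_dil; apply: approximatesM; apply: approximates_trunc.
by rewrite comp_polyM; apply: approximatesM; apply: approximates_dil;
  apply: approximates_trunc.
Qed.

HB.instance Definition _ :=
  GRing.isZmodMorphism.Build (fps R) (fps R) dil dil_is_zmod_morphism.
HB.instance Definition _ :=
  GRing.isMonoidMorphism.Build (fps R) (fps R) dil dil_is_monoid_morphism.

Definition xderiv s : fps R := Fps (fun N => s N *+ N).

Lemma fps_xderiv s N : xderiv s N = s N *+ N. Proof. by []. Qed.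

Lemma fps_xderiv0 s : xderiv s 0 = 0. Proof. exact: mulr0n. Qed.

Lemma xderiv_is_zmod_morphism : zmod_morphism xderiv.
Proof. by move=> s t; apply/fpsP => N /=; rewrite mulrnBl. Qed.

HB.instance Definition _ :=
  GRing.isZmodMorphism.Build (fps R) (fps R) xderiv xderiv_is_zmod_morphism.

Lemma xderivM s t : xderiv (s * t) = xderiv s * t + s * xderiv t.
Proof.
apply/fpsP => N; rewrite fpsD fps_xderiv !fpsM -sumrMnl -big_split.
apply: eq_bigr => i _ /=; rewrite mulrnAl mulrnAr -mulrnDr.
by congr (_ *+ _); move: (ltn_ord i); lia.
Qed.

Lemma xderivX s k : xderiv (s ^+ k.+1) = k.+1%:R * s ^+ k * xderiv s.
Proof.
elim: k => [|k IH]; first by rewrite expr1 expr0; ring.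
by rewrite exprS xderivM IH !exprS -!natr1; ring.
Qed.

Lemma xderiv_natM k s : xderiv (k%:R * s) = k%:R * xderiv s.
Proof. by rewrite !mulr_natl raddfMn. Qed.

Lemma xderiv_dil s : xderiv (dil s) = 2 * dil (xderiv s).
Proof.
apply/fpsP => N; rewrite fps_natM /=; case: ifP => [|/negbT/even_halfK eN].
  by rewrite mul0rn mulr0.
by rewrite mulr_natl -mulrnA muln2 eN.
Qed.

Definition vanishes_below k s := forall i, (i < k)%N -> s i = 0.

Lemma vanishes_belowM j k s t :
  vanishes_below j s -> vanishes_below k t -> vanishes_below (j + k) (s * t).
Proof.
move=> s0 t0 N ltN; rewrite fpsM big1 // => i _.
have [/s0->|leji] := ltnP i j; first by rewrite mul0r.
by rewrite (t0 (N - i)%N) ?mulr0 //; move: (ltn_ord i); lia.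
Qed.

Lemma vanishes_belowMr k s t : vanishes_below k s -> vanishes_below k (s * t).
Proof. by rewrite -{2}[k]addn0 => s0; apply: vanishes_belowM. Qed.

Lemma vanishes_belowX k s n : vanishes_below k s -> vanishes_below (n * k) (s ^+ n).
Proof.
by move=> s0; elim: n => [|n IH] //; rewrite mulSn exprS; apply: vanishes_belowM.
Qed.

Lemma fpsM_lowest j k s t :
  vanishes_below j s -> vanishes_below k t -> (s * t) (j + k)%N = s j * t k.
Proof.
move=> s0 t0; have ltj : (j < (j + k).+1)%N by lia.
rewrite fpsM (bigD1 (Ordinal ltj)) //= big1 ?addr0 ?addKn // => i.
rewrite -val_eqE /= => neij; have [/s0->|leji] := ltnP i j; first by rewrite mul0r.
by rewrite (t0 (j + k - i)%N) ?mulr0 //; move: (ltn_ord i); lia.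
Qed.

(** * Supports in residue classes *)

Definition supported d r s := forall N, s N != 0 -> N = r %[mod d].

Lemma supported_eq0 d r s N : supported d r s -> N != r %[mod d] -> s N = 0.
Proof. by move=> sr; apply: contraNeq => /sr ->. Qed.

Lemma supported_eqmod d r r' s : r = r' %[mod d] -> supported d r s -> supported d r' s.
Proof. by move=> rr' sr N /sr ->. Qed.

Lemma supportedW d d' r s : (d' %| d)%N -> supported d r s -> supported d' r s.
Proof. by move=> d'd sr N /sr eN; rewrite -(modn_dvdm N d'd) eN modn_dvdm. Qed.

Lemma supportedM d r r' s t :
  supported d r s -> supported d r' t -> supported d (r + r') (s * t).
Proof.
move=> sr tr' N; apply: contraNeq => neqN; rewrite fpsM big1 // => i _.
apply/eqP; apply: contraNT neqN => nz.
have [/sr si /tr' ti] : s i != 0 /\ t (N - i)%N != 0.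
  by split; apply: contraNneq nz => ->; rewrite ?mulr0 ?mul0r.
by apply/eqP; rewrite -modnDm -si -ti modnDm subnKC // -ltnS.
Qed.

Lemma supported1 d : supported d 0 1.
Proof. by move=> [|N]; rewrite fps1 ?eqxx. Qed.

Lemma supportedX d r s k : supported d r s -> supported d (k * r) (s ^+ k).
Proof.
move=> sr; elim: k => [|k IH]; first exact: supported1.
by rewrite exprS mulSn; apply: supportedM.
Qed.

Lemma supported_dil d r s : supported d r s -> supported d.*2 r.*2 (dil s).
Proof.
move=> sr N; rewrite fps_dil; case: ifPn => [|/even_halfK eN /sr]; first by rewrite eqxx.
by rewrite -{2}eN -!muln2 -!muln_modl => ->.
Qed.

Definition fpsXn d : {pred fps R} := [pred s | `[< supported d 0 s >]].

Lemma fpsXnP d s : reflect (supported d 0 s) (s \in fpsXn d).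
Proof. exact: asboolP. Qed.

Lemma fpsXn_subring_closed d : subring_closed (fpsXn d).
Proof.
split=> [|s t /fpsXnP s0 /fpsXnP t0|s t /fpsXnP s0 /fpsXnP t0]; apply/fpsXnP.
- exact: supported1.
- move=> N; rewrite fpsD fpsN; have [sN|/s0 //] := eqVneq (s N) 0.
  by rewrite sN add0r oppr_eq0; apply: t0.
- exact: supportedM s0 t0.
Qed.

HB.instance Definition _ d :=
  GRing.isSubringClosed.Build (fps R) (fpsXn d) (fpsXn_subring_closed d).

Lemma supportedMr d r s t : supported d r s -> t \in fpsXn d -> supported d r (s * t).
Proof. by move=> sr /fpsXnP t0; rewrite -[r]addn0; apply: supportedM. Qed.

End FpsRing.

Section FpsDomain.
Context {R : idomainType}.
Implicit Types s t u w y : fps R.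

Lemma fps_neq0_lowest s : s != 0 -> exists2 k, vanishes_below k s & s k != 0.
Proof.
move=> nz_s; have /existsNP[i si] : ~ s =1 (0 : fps R).
  by move=> /fpsP s0; rewrite s0 eqxx in nz_s.
have ex : exists i, s i != 0 by exists i; apply/eqP.
exists (ex_minn ex); case: ex_minnP => // k _ min_k j ltjk.
by apply: contraTeq ltjk => /min_k; rewrite -leqNgt.
Qed.

(* Integral domains are unit rings in the hierarchy; inverses exist by choice. *)
Definition fps_unit : {pred fps R} := [pred s | `[< exists t, t * s = 1 >]].
Definition fps_inv s : fps R :=
  if pselect (exists t, t * s = 1) is left unit_s then projT1 (cid unit_s) else s.

Lemma fps_mulVr : {in fps_unit, left_inverse 1 fps_inv *%R}.
Proof.
by move=> s /asboolP unit_s; rewrite /fps_inv; case: pselect => // ?; case: cid.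
Qed.

Lemma fps_unitP s t : t * s = 1 -> s \in fps_unit.
Proof. by move=> ts1; apply/asboolP; exists t. Qed.

Lemma fps_inv_out : {in [predC fps_unit], fps_inv =1 id}.
Proof. by move=> s /asboolP nunit_s; rewrite /fps_inv; case: pselect. Qed.

HB.instance Definition _ := GRing.ComNzRing_hasMulInverse.Build (fps R)
  fps_mulVr fps_unitP fps_inv_out.

Lemma fps_mulf_eq0 s t : s * t = 0 -> (s == 0) || (t == 0).
Proof.
move=> st0; apply/norP => -[/fps_neq0_lowest[j s0 sj] /fps_neq0_lowest[k t0 tk]].
have /eqP := fpsM_lowest s0 t0.
by rewrite st0 eq_sym mulf_eq0 (negbTE sj) (negbTE tk).
Qed.

HB.instance Definition _ := GRing.ComUnitRing_isIntegral.Build (fps R) fps_mulf_eq0.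

(* The right-hand side doubles the lowest exponent of [y], the left-hand side
   only shifts it by [k]. *)
Lemma dil_fixpoint_eq0 u w y k :
    vanishes_below k u -> u k != 0 -> vanishes_below k.+1 y -> u * y = dil (w * y) ->
  y = 0.
Proof.
move=> u0 uk yk uyE; apply: contra_eq uyE => /fps_neq0_lowest[v y0 yv].
have ltkv : (k < v)%N by rewrite ltnNge; apply: contra yv => /yk ->.
apply/eqP => /(congr1 (fun s : fps R => s (k + v)%N)).
rewrite fpsM_lowest // fps_dil mulrC [w * y]mulrC (vanishes_belowMr w y0).
  by rewrite if_same => /eqP; rewrite mulf_eq0 (negbTE uk) (negbTE yv).
by lia.
Qed.

End FpsDomain.

Lemma fps_natr_neq0 (R : numDomainType) k : k.+1%:R != 0 :> fps R.
Proof.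
apply/eqP => /(congr1 (fun s : fps R => s 0%N))/eqP.
by rewrite fpsMn fps1 fps0 pnatr_eq0.
Qed.

(** * Theta series of the even and of the odd integers *)

(* [window e B] lists the integers of parity [e] in [[- B.*2 - e, B.*2 + e]];
   halved, these are the coordinates that [shellZ] ([e = false]) and [shellSh]
   ([e = true]) enumerate. *)
Definition window_size (e : bool) (B : nat) : nat := if e then B.*2.+2 else B.*2.+1.
Definition window_elt (e : bool) (B k : nat) : int := k.*2%:Z - (B.*2 + e)%:Z.
Definition window (e : bool) (B : nat) : seq int :=
  [seq window_elt e B k | k <- iota 0 (window_size e B)].

Lemma window_uniq e B : uniq (window e B).
Proof. by rewrite map_inj_uniq ?iota_uniq // => j k; rewrite /window_elt; lia. Qed.

Lemma mem_window e B y :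
  (y \in window e B) = (`|y| <= B.*2 + e)%N && (odd `|y| == e).
Proof.
apply/mapP/andP => [[k]|[ley /eqP oddy]].
  by rewrite mem_iota /window_size /window_elt => ltk ->; case: e ltk => /=; lia.
exists (absz (y + (B.*2 + e)%:Z))./2; rewrite ?mem_iota /window_size /window_elt.
  by case: e ley oddy => /=; lia.
by case: e ley oddy => /=; lia.
Qed.

Lemma big_window {R : Type} {idx : R} (op : Monoid.law idx) e B (P : pred int) (F : int -> R) :
  \big[op/idx]_(y <- window e B | P y) F y =
  \big[op/idx]_(k < window_size e B | P (window_elt e B k)) F (window_elt e B k).
Proof. by rewrite /window big_map -{1}(subn0 (window_size e B)) big_mkord. Qed.

Lemma natr_absz_sqr (R : pzRingType) (y : int) : (`|y| ^ 2)%N%:R = y%:~R ^+ 2 :> R.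
Proof.
have sqE : (`|y| ^ 2)%N%:Z = y ^+ 2.
  by rewrite -natz natrX natz abszE real_normK ?num_real.
by rewrite pmulrn sqE rmorphXn.
Qed.

Section ThetaMoments.
Context {R : numDomainType}.
Implicit Types (e : bool) (B N : nat).

Definition theta_moment e j : fps R :=
  Fps (fun N => \sum_(y <- window e N | (`|y| ^ 2 == N)%N) y%:~R ^+ j).

Definition theta e : fps R := theta_moment e 0.

Lemma theta_moment_window e j B N : (N <= B.*2 ^ 2)%N ->
  theta_moment e j N = \sum_(y <- window e B | (`|y| ^ 2 == N)%N) y%:~R ^+ j.
Proof.
move=> leN; rewrite /= -big_filter -[RHS]big_filter; apply: perm_big.
apply: uniq_perm; rewrite ?filter_uniq ?window_uniq // => y.
rewrite !mem_filter !mem_window; have [yN|//] := eqVneq (`|y| ^ 2)%N N.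
have -> : (`|y| <= N.*2 + e)%N by rewrite -yN; nia.
by have -> : (`|y| <= B.*2 + e)%N by rewrite -yN leq_exp2r // in leN; lia.
Qed.

Lemma theta_momentSS e j : theta_moment e j.+2 = xderiv (theta_moment e j).
Proof.
apply/fpsP => N; rewrite fps_xderiv -sumrMnl; apply: eq_bigr => y /eqP yN.
by rewrite -addn2 exprD -mulr_natr -yN natr_absz_sqr.
Qed.

Lemma theta_moment_odd e j : odd j -> theta_moment e j = 0.
Proof.
move=> oddj; apply/fpsP => N; rewrite /= -big_filter; set S := [seq _ <- _ | _].
have permS : perm_eq S [seq - y | y <- S].
  apply: uniq_perm; rewrite ?(map_inj_uniq oppr_inj) ?filter_uniq ?window_uniq // => y.
  by rewrite -[in RHS](opprK y) (mem_map oppr_inj) !mem_filter !mem_window abszN.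
have : \sum_(y <- S) (y%:~R : R) ^+ j = - \sum_(y <- S) y%:~R ^+ j.
  rewrite {1}(perm_big _ permS) big_map -sumrN; apply: eq_bigr => y _.
  by rewrite rmorphN exprNn -signr_odd oddj expr1 mulN1r.
by move/eqP; rewrite -addr_eq0 -mulr2n mulrn_eq0 => /eqP.
Qed.

Definition theta_moment_poly e j B : {poly R} :=
  \sum_(y <- window e B) y%:~R ^+ j *: 'X^(`|y| ^ 2).

Lemma approximates_theta_moment e j B N : (N <= B.*2 ^ 2)%N ->
  approximates N (theta_moment_poly e j B) (theta_moment e j).
Proof.
move=> leN i leiN; rewrite (@theta_moment_window e j B) ?(leq_trans leiN) //.
rewrite coef_sum [RHS]big_mkcond; apply: eq_bigr => y _.
by rewrite coefZ coefXn eq_sym; case: ifP; rewrite ?mulr1 ?mulr0.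
Qed.

Lemma prod_theta_moment n e (m : 'I_n -> nat) B N : (N <= B.*2 ^ 2)%N ->
  (\prod_i theta_moment e (m i)) N =
  \sum_(k : {ffun 'I_n -> 'I_(window_size e B)}
         | (\sum_i `|window_elt e B (k i)| ^ 2 == N)%N)
     \prod_i (window_elt e B (k i))%:~R ^+ m i.
Proof.
move=> leN; rewrite -(approximates_prod (fun i => approximates_theta_moment e (m i) leN)) //.
under eq_bigr do rewrite /theta_moment_poly big_window.
rewrite bigA_distr_bigA /= coef_sum [RHS]big_mkcond; apply: eq_bigr => k _.
rewrite scaler_prod prodrXr coefZ coefXn eq_sym.
by case: ifP => _; rewrite ?mulr1 ?mulr0.
Qed.

(** * Rotating the plane by 45 degrees *)

Definition circle e e' N : seq (int * int) :=
  [seq p <- [seq (y, z) | y <- window e N, z <- window e' N]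
     | (`|p.1| ^ 2 + `|p.2| ^ 2 == N)%N].

Lemma circle_uniq e e' N : uniq (circle e e' N).
Proof.
by rewrite filter_uniq // allpairs_uniq ?window_uniq // => -[? ?] [? ?].
Qed.

Lemma sqrz_addE (y z : int) N :
  (y ^+ 2 + z ^+ 2 == N%:Z) = (`|y| ^ 2 + `|z| ^ 2 == N)%N.
Proof. by rewrite -[y]intz -[z]intz -!natr_absz_sqr !natz -PoszD !intz. Qed.

Lemma mem_circle e e' N y z : ((y, z) \in circle e e' N) =
  [&& odd `|y| == e, odd `|z| == e' & y ^+ 2 + z ^+ 2 == N%:Z].
Proof.
rewrite sqrz_addE mem_filter; apply/andP/and3P => /=.
  case=> eN /allpairsP[[? ?] /= [wy wz [yE zE]]].
  by move: wy wz; rewrite yE zE !mem_window in eN * => /andP[_ ?] /andP[_ ?]; split.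
case=> oy oz eN; split=> //; apply/allpairsP; exists (y, z).
by rewrite /= !mem_window oy oz -(eqP eN) !andbT; split=> //; nia.
Qed.

Lemma thetaM_circle e e' N : (theta e * theta e') N = (size (circle e e' N))%:R.
Proof.
have leN : (N <= N.*2 ^ 2)%N by nia.
rewrite -(approximatesM (approximates_theta_moment e 0 leN)
  (approximates_theta_moment e' 0 leN)) // /theta_moment_poly mulr_suml coef_sum.
rewrite -sum1_size natr_sum /circle big_filter [RHS]big_mkcond [RHS]big_allpairs_dep /=.
apply: eq_bigr => y _; rewrite mulr_sumr coef_sum; apply: eq_bigr => z _.
by rewrite !expr0 !scale1r -exprD coefXn eq_sym; case: eqP.
Qed.

Lemma circle_diag_odd e N : odd N -> circle e e N = [::].
Proof.
move=> oddN; case: circle (@mem_circle e e N) => [//|[y z] s] memc.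
have := memc y z; rewrite mem_head sqrz_addE => /esym/and3P[/eqP oy /eqP oz /eqP sN].
by move: oddN; rewrite -sN oddD !oddX /= oy oz addbb.
Qed.

(* [(u, v) |-> (u + v, u - v)] is a similarity of ratio [sqrt 2] from the pairs
   with [u + v] of parity [e] onto the pairs of integers of parity [e]. *)
Lemma perm_circle_double e N :
  perm_eq (circle e e N.*2)
    [seq (p.1 + p.2, p.1 - p.2) | p <- circle false e N ++ circle true (~~ e) N].
Proof.
apply: uniq_perm; first exact: circle_uniq.
  rewrite map_inj_uniq ?cat_uniq ?circle_uniq ?andbT /=; last first.
    by case=> [u v] [u' v'] [] /= eqD eqB; congr (_, _); lia.
  by apply/hasPn => -[u v]; rewrite !mem_circle => /and3P[/eqP -> _ _].
case=> y z; rewrite mem_circle; apply/and3P/mapP => [[/eqP oy /eqP oz /eqP sN]|].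
  have [u yE] : exists u, y = u * 2 - z by exists ((y + z) %/ 2)%Z; clear -oy oz; lia.
  exists (u, u - z); last by rewrite yE; congr (_, _) => /=; ring.
  have sM : u ^+ 2 + (u - z) ^+ 2 = N%:Z.
    by apply: (@mulfI _ 2) => //; rewrite -PoszM mul2n -sN yE; ring.
  rewrite mem_cat !mem_circle sM eqxx !andbT.
  have -> : odd `|u - z| = odd `|u| (+) e by rewrite -oz; clear; lia.
  by case: (odd `|u|); case: (e).
case=> -[u v]; rewrite mem_cat !mem_circle /= => uv [-> ->].
have [ou sM] : odd `|u| (+) odd `|v| = e /\ u ^+ 2 + v ^+ 2 = N%:Z.
  by case/orP: uv => /and3P[/eqP -> /eqP -> /eqP ->]; split=> //; case: (e).
split; [by rewrite -ou; apply/eqP; clear; lia | by rewrite -ou; apply/eqP; clear; lia |].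
by rewrite -mul2n PoszM -sM; apply/eqP; ring.
Qed.

Lemma theta_sqr e :
  theta e ^+ 2 = dil (theta false * theta e + theta true * theta (~~ e)).
Proof.
apply/fpsP => N; rewrite expr2 thetaM_circle fps_dil; case: ifPn => [/circle_diag_odd -> //|].
move=> /even_halfK eN; rewrite -{1}eN (perm_size (perm_circle_double e N./2)).
by rewrite size_map size_cat natrD -!thetaM_circle.
Qed.

End ThetaMoments.

(** * Differential equations of the theta series *)

Section Brackets.
Context {R : comNzRingType}.
Implicit Types s t : fps R.

Definition wronskian s t := s * xderiv t - t * xderiv s.

(* For [s] of weight [k] and [c = 1 + 1 / k], a multiple of the second
   Rankin-Cohen bracket of [s] with itself. For [theta e] and [c = 3] it is also
   [theta e ^ 2] times the fourth cumulant of the weights [x ^ (y ^ 2)]. *)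
Definition rankin_cohen c s := s * xderiv (xderiv s) - c%:R * xderiv s ^+ 2.

Definition cumulant6 s := s ^+ 2 * xderiv (xderiv (xderiv s))
  - 15 * s * xderiv s * xderiv (xderiv s) + 30 * xderiv s ^+ 3.

Lemma wronskianC s t : wronskian s t = - wronskian t s.
Proof. by rewrite /wronskian opprB. Qed.

Lemma wronskian_dil s t : wronskian (dil s) (dil t) = 2 * dil (wronskian s t).
Proof. by rewrite /wronskian !xderiv_dil rmorphB !rmorphM /=; ring. Qed.

Lemma wronskian_sqr s t : wronskian (s ^+ 2) (t ^+ 2) = 2 * s * t * wronskian s t.
Proof. by rewrite /wronskian !xderivX; ring. Qed.

Lemma wronskian_sqrD s t : wronskian (s ^+ 2 + t ^+ 2) (2 * (s * t)) =
  2 * (s ^+ 2 - t ^+ 2) * wronskian s t.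
Proof. by rewrite /wronskian raddfD /= xderiv_natM xderivM !xderivX; ring. Qed.

Lemma rankin_cohen_dil c s : rankin_cohen c (dil s) = 4 * dil (rankin_cohen c s).
Proof.
rewrite /rankin_cohen !xderiv_dil xderiv_natM xderiv_dil.
by rewrite rmorphB !rmorphM rmorph_nat /=; ring.
Qed.

Lemma rankin_cohen2_sqr s : rankin_cohen 2 (s ^+ 2) = 2 * s ^+ 2 * rankin_cohen 3 s.
Proof.
by rewrite /rankin_cohen !xderivX expr1 -mulrA xderiv_natM xderivM; ring.
Qed.

Lemma rankin_cohen2_sqrD s t : rankin_cohen 2 (s ^+ 2 + t ^+ 2) =
  2 * (s ^+ 2 + t ^+ 2) * (rankin_cohen 3 s + rankin_cohen 3 t) + 8 * wronskian s t ^+ 2.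
Proof.
rewrite /rankin_cohen /wronskian raddfD /= !xderivX !expr1 -!mulrA.
by rewrite raddfD /= !xderiv_natM !xderivM; ring.
Qed.

Lemma rankin_cohen3_wronskian s t :
  s ^+ 2 * rankin_cohen 3 t - t ^+ 2 * rankin_cohen 3 s =
  s * t * xderiv (wronskian s t) - 3 * xderiv (s * t) * wronskian s t.
Proof.
by rewrite /rankin_cohen /wronskian raddfB /= !xderivM; ring.
Qed.

Lemma cumulant6E s : cumulant6 s =
  s * xderiv (rankin_cohen 3 s) - 10 * xderiv s * rankin_cohen 3 s.
Proof.
by rewrite /cumulant6 /rankin_cohen raddfB /= xderiv_natM xderivM xderivX; ring.
Qed.

End Brackets.

Section ThetaDifferential.
Context {R : numDomainType}.

Local Notation A := (@theta R false).
Local Notation B := (@theta R true).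

Lemma supported_theta_even : supported 4 0 A.
Proof.
move=> N; apply: contraNeq => neqN; rewrite /= big1_seq // => y.
rewrite mem_window => /andP[/eqP yN /andP[_ /eqP oy]]; case/negP: neqN.
by rewrite -yN -(odd_double_half `|y|) oy add0n -muln2 expnMn modnMl.
Qed.

Lemma supported_theta_odd : supported 8 1 B.
Proof.
move=> N; apply: contraNeq => neqN; rewrite /= big1_seq // => y.
rewrite mem_window => /andP[/eqP yN /andP[_ /eqP oy]]; case/negP: neqN.
rewrite -yN -(odd_double_half `|y|) oy; move: (`|y|./2)%N => k.
have -> : ((true + k.*2) ^ 2 = (k * k.+1)./2 * 8 + 1)%N.
  have := odd_double_half (k * k.+1); rewrite oddM /= andbN add0n.
  by move: (k * k.+1)./2 => h; nia.
by rewrite modnMDl.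
Qed.

Lemma theta_even0 : A 0 = 1.
Proof. by rewrite /= /window /= !big_cons big_nil /= addr0. Qed.

Lemma vanishes_below_theta_odd : vanishes_below 1 B.
Proof. by case=> // _; apply: supported_eq0 supported_theta_odd _. Qed.

Lemma theta_odd1 : B 1 = 2.
Proof. by rewrite (@theta_moment_window _ _ _ 1) // /window /= !big_cons big_nil /= addr0. Qed.

Lemma theta_neq0 e : theta e != 0 :> fps R.
Proof.
apply/eqP => /(congr1 (fun s : fps R => s e)); case: e.
  by move/eqP; rewrite theta_odd1 fps0 pnatr_eq0.
by move/eqP; rewrite theta_even0 fps0 oner_eq0.
Qed.

Lemma theta_even_sqr : A ^+ 2 = dil (A ^+ 2 + B ^+ 2).
Proof. by rewrite [LHS]theta_sqr !expr2. Qed.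

Lemma theta_odd_sqr : B ^+ 2 = dil (2 * (A * B)).
Proof. by rewrite theta_sqr [B * _]mulrC mulr_natl mulr2n. Qed.

Definition theta_sum : fps R := A ^+ 4 + B ^+ 4.
Definition theta_prod : fps R := A ^+ 2 * B ^+ 2.

Lemma theta_even_X4 : A ^+ 4 = dil (theta_sum + 2 * theta_prod).
Proof.
by rewrite (exprM _ 2 2) theta_even_sqr -rmorphXn /theta_sum /theta_prod; congr dil; ring.
Qed.

Lemma theta_odd_X4 : B ^+ 4 = dil (4 * theta_prod).
Proof.
by rewrite (exprM _ 2 2) theta_odd_sqr -rmorphXn /theta_prod; congr dil; ring.
Qed.

Lemma theta_X4D : A ^+ 4 + B ^+ 4 = dil (theta_sum + 6 * theta_prod).
Proof. by rewrite theta_odd_X4 theta_even_X4 -rmorphD; congr dil; ring. Qed.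

Lemma theta_X4B : A ^+ 4 - B ^+ 4 = dil (theta_sum - 2 * theta_prod).
Proof. by rewrite theta_odd_X4 theta_even_X4 -rmorphB; congr dil; ring. Qed.

Lemma theta_X4B_sqr : (A ^+ 4 - B ^+ 4) ^+ 2 =
  (theta_sum - 2 * theta_prod) * (theta_sum + 2 * theta_prod).
Proof. by rewrite /theta_sum /theta_prod; ring. Qed.

(* Up to a constant, the square root of the modular discriminant. *)
Definition theta_disc : fps R := A ^+ 4 * B ^+ 4 * (A ^+ 4 - B ^+ 4).

Lemma theta_disc_dil : theta_disc = dil (4 * theta_prod * (A ^+ 4 - B ^+ 4) ^+ 2).
Proof.
rewrite theta_X4B_sqr /theta_disc theta_X4B theta_even_X4 theta_odd_X4 -!rmorphM.
by congr dil; ring.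
Qed.

Lemma vanishes_below_theta_wronskian :
  vanishes_below 2 (wronskian A B - A * B * (A ^+ 4 - B ^+ 4)).
Proof.
have B0 := @vanishes_below_theta_odd; have B'0 : vanishes_below 1 (xderiv B) by case.
have coef1 s t : vanishes_below 1 s -> (s * t) 1%N = s 1%N * t 0%N.
  by move=> s0; rewrite -[1%N]addn0 (fpsM_lowest s0).
have V0 : (A ^+ 4 - B ^+ 4) 0%N = 1.
  by rewrite fpsD fpsN !fpsX0 theta_even0 B0 // expr1n expr0n subr0.
case=> [|[|//]] _; rewrite /wronskian [A * xderiv B]mulrC [A * B]mulrC 2!fpsD 2!fpsN.
  by rewrite !fpsM0 !fps_xderiv0 B0 // !mul0r !subr0.
rewrite -mulrA !coef1 // fpsM0 !fps_xderiv0 V0 theta_even0 fps_xderiv theta_odd1.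
by rewrite mulr1n mulr0 !mulr1 subr0 subrr.
Qed.

Lemma theta_wronskian_even : wronskian A B = A * B * (A ^+ 4 - B ^+ 4).
Proof.
apply/eqP; rewrite -subr_eq0; apply/eqP.
have B0 := @vanishes_below_theta_odd.
apply: (dil_fixpoint_eq0 (u := B * A) (w := 2 * (A ^+ 2 - B ^+ 2))
  (vanishes_belowMr _ B0) _ vanishes_below_theta_wronskian).
  by rewrite -[1%N]addn0 (fpsM_lowest B0) // theta_odd1 theta_even0 mulr1 pnatr_eq0.
apply: (mulfI (fps_natr_neq0 R 1)).
transitivity (wronskian (A ^+ 2) (B ^+ 2) - 2 * (A ^+ 2 * B ^+ 2 * (A ^+ 4 - B ^+ 4))).
  by rewrite wronskian_sqr; ring.
have -> : A ^+ 2 * B ^+ 2 * (A ^+ 4 - B ^+ 4) =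
    dil (2 * (A ^+ 2 - B ^+ 2) * (A * B * (A ^+ 4 - B ^+ 4))).
  rewrite {1}theta_odd_sqr {1}theta_even_sqr {1}theta_X4B -!rmorphM; congr dil.
  by rewrite /theta_sum /theta_prod; ring.
rewrite {1}theta_odd_sqr {1}theta_even_sqr wronskian_dil wronskian_sqrD.
by rewrite -mulrBr -rmorphB; congr (_ * dil _); ring.
Qed.

Lemma theta_wronskian e : wronskian (theta e) (theta (~~ e)) =
  theta e * theta (~~ e) * (theta e ^+ 4 - theta (~~ e) ^+ 4) :> fps R.
Proof.
case: e; last exact: theta_wronskian_even.
by rewrite wronskianC theta_wronskian_even -mulrN opprB [A * B]mulrC.
Qed.

Lemma theta_rankin_cohen_diff e :
  theta e ^+ 2 * rankin_cohen 3 (theta (~~ e)) - theta (~~ e) ^+ 2 * rankin_cohen 3 (theta e)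
  = - 2 * theta e ^+ 2 * theta (~~ e) ^+ 2 * (theta e ^+ 8 - theta (~~ e) ^+ 8) :> fps R.
Proof.
rewrite rankin_cohen3_wronskian.
have := theta_wronskian e; set s := theta e; set t := theta (~~ e) => W.
rewrite W !(xderivM, raddfB) /= !xderivX.
transitivity (- 2 * (s * t) * (s ^+ 4 + t ^+ 4) * wronskian s t).
  by rewrite /wronskian; ring.
by rewrite W; ring.
Qed.

Lemma theta_even_rankin_cohen :
  rankin_cohen 3 A = 2 * A ^+ 2 * B ^+ 4 * (A ^+ 4 - B ^+ 4).
Proof.
apply/eqP; rewrite -subr_eq0; apply/eqP; set y := _ - _.
pose H := A ^+ 2 + B ^+ 2.
have HE : A ^+ 2 * rankin_cohen 2 H =
    2 * H ^+ 2 * y + 4 * A ^+ 4 * B ^+ 2 * (A ^+ 4 - B ^+ 4) ^+ 2.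
  rewrite /y /H rankin_cohen2_sqrD theta_wronskian_even.
  transitivity (2 * (A ^+ 2 + B ^+ 2) * ((A ^+ 2 + B ^+ 2) * rankin_cohen 3 A
    + (A ^+ 2 * rankin_cohen 3 B - B ^+ 2 * rankin_cohen 3 A))
    + 8 * A ^+ 4 * B ^+ 2 * (A ^+ 4 - B ^+ 4) ^+ 2); first by ring.
  by rewrite (theta_rankin_cohen_diff false); ring.
have yE : A ^+ 2 * y =
    2 * dil (rankin_cohen 2 H - 4 * (A ^+ 2 * B ^+ 2 * (A ^+ 4 - B ^+ 4) ^+ 2)).
  apply: (mulfI (fps_natr_neq0 R 1)).
  transitivity (rankin_cohen 2 (A ^+ 2) - 4 * theta_disc).
    by rewrite rankin_cohen2_sqr /y /theta_disc; ring.
  rewrite theta_disc_dil /theta_prod {1}theta_even_sqr rankin_cohen_dil -/H.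
  by rewrite -[4 * _ * _]mulrA [in RHS]rmorphB [dil (4 * _)]rmorphM rmorph_nat /=; ring.
apply: (@dil_fixpoint_eq0 _ (dil (A ^+ 2) * A ^+ 2) (4 * H ^+ 2) _ 0) => //.
- by rewrite fpsM0 (fps_dil_double _ 0) !fpsX0 theta_even0 !expr1n mulr1 oner_eq0.
- case=> // _; rewrite /y /rankin_cohen !(fpsD, fpsN, fpsX0, fpsM0, fps_xderiv0).
  by rewrite vanishes_below_theta_odd // !expr0n !(mulr0, mul0r, subr0).
rewrite -mulrA yE mulrCA -!rmorphM -(rmorph_nat dil) -rmorphM; congr dil.
by rewrite mulrBr HE; ring.
Qed.

Lemma theta_rankin_cohen e : rankin_cohen 3 (theta e) =
  2 * theta e ^+ 2 * theta (~~ e) ^+ 4 * (theta e ^+ 4 - theta (~~ e) ^+ 4) :> fps R.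
Proof.
case: e; last exact: theta_even_rankin_cohen.
apply: (mulfI (expf_neq0 2 (theta_neq0 false))).
have /eqP := theta_rankin_cohen_diff false; rewrite subr_eq => /eqP ->.
by rewrite theta_even_rankin_cohen; ring.
Qed.

Lemma theta_cumulant6 e : cumulant6 (theta e) =
  8 * theta e ^+ 3 * theta (~~ e) ^+ 4 * (theta e ^+ 4 - theta (~~ e) ^+ 4)
    * (theta e ^+ 4 - 2 * theta (~~ e) ^+ 4) :> fps R.
Proof.
rewrite cumulant6E theta_rankin_cohen -!mulrA xderiv_natM !(xderivM, raddfB) /= !xderivX.
have := theta_wronskian e; set s := theta e; set t := theta (~~ e) => W.
transitivity (8 * s ^+ 2 * t ^+ 3 * (s ^+ 4 - 2 * t ^+ 4) * wronskian s t).
  by rewrite /wronskian; ring.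
by rewrite W; ring.
Qed.

End ThetaDifferential.

(** * Theta series with harmonic coefficients *)

Section SumOfPureDerivatives.
Context {R : nzRingType} {n : nat}.
Implicit Types P : {mpoly R[n]}.

Definition sum_mderivn k P : {mpoly R[n]} := \sum_i P^`M(i, k).

Lemma sum_mderivn_is_linear k : linear (sum_mderivn k).
Proof.
move=> c P Q; rewrite /sum_mderivn scaler_sumr -big_split.
by apply: eq_bigr => i _; rewrite linearP.
Qed.

HB.instance Definition _ k :=
  GRing.isLinear.Build R {mpoly R[n]} {mpoly R[n]} *:%R (sum_mderivn k)
    (sum_mderivn_is_linear k).

Lemma mdeg_msupp_mderivn P d i k m :
  P \is d.-homog -> m \in msupp P^`M(i, k) -> (k + mdeg m = d)%N.
Proof.
move=> homP; rewrite mcoeff_msupp mcoeff_mderivm => nz.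
have : P@_(U_(i) *+ k + m) != 0 by apply: contraNneq nz => ->; rewrite mul0rn.
rewrite -mcoeff_msupp => /(dhomog_mf homP) /=.
by rewrite mdegD mdegMn mdeg1 mul1n.
Qed.

Lemma dhomog_sum_mderivn P d k : P \is (k + d).-homog -> sum_mderivn k P \is d.-homog.
Proof.
move=> homP; rewrite rpred_sum // => i _; apply/dhomogP => m mP.
by apply: (@addnI k); apply: mdeg_msupp_mderivn homP mP.
Qed.

Lemma sum_mderivn_eq0 P d k : P \is d.-homog -> (d < k)%N -> sum_mderivn k P = 0.
Proof.
move=> homP ltdk; apply: big1 => i _; apply/eqP; rewrite -msupp_eq0.
case suppE: (msupp _) => [//|m s].
by have := @mdeg_msupp_mderivn P d i k m homP; rewrite suppE mem_head => /(_ isT); lia.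
Qed.

Lemma sum_mderivnC P k l : sum_mderivn k (sum_mderivn l P) = sum_mderivn l (sum_mderivn k P).
Proof.
rewrite /sum_mderivn; under eq_bigr do rewrite raddf_sum.
under [RHS]eq_bigr do rewrite raddf_sum.
by rewrite exchange_big; do 2!apply: eq_bigr => ? _; rewrite /= -!mderivmDm addmC.
Qed.

Lemma dhomog0_const P : P \is 0.-homog -> P = (P@_0)%:MP.
Proof.
move=> homP; apply/mpolyP => m; rewrite mcoeffC.
have [->|nz_m] := eqVneq m 0%MM; first by rewrite mulr1.
by rewrite mulr0 (dhomog_nemf_coeff homP) //= mdeg_eq0.
Qed.

End SumOfPureDerivatives.

Lemma meval_dhomog (R : comNzRingType) n (P : {mpoly R[n]}) d c (v : 'I_n -> R) :
  P \is d.-homog -> P.@[fun i => c * v i] = c ^+ d * P.@[v].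
Proof.
move=> homP; rewrite !mevalE mulr_sumr; apply: eq_big_seq => m mP.
rewrite -(dhomog_mf homP mP) /= mdegE mulrCA; congr (_ * _).
by under eq_bigr do rewrite exprMn; rewrite big_split prodrXr.
Qed.

(* In the plane the second derivatives of a harmonic polynomial are opposite. *)
Lemma sum_mderivn_plane_eq0 (R : nzRingType) (P : {mpoly R[2]}) k :
  sum_mderivn 2 P = 0 -> odd k -> sum_mderivn k.*2 P = 0.
Proof.
have sum2 j (Q : {mpoly R[2]}) : sum_mderivn j Q = Q^`M(ord0, j) + Q^`M(ord_max, j).
  by rewrite /sum_mderivn big_ord_recl big_ord1; congr (_ + _^`M(_, _)); apply: val_inj.
move=> harmP oddk; suff swap j : P^`M(ord0, j.*2) = (-1) ^+ j *: P^`M(ord_max, j.*2).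
  by rewrite sum2 swap -signr_odd oddk expr1 scaleN1r addNr.
elim: j => [|j IH]; first by rewrite expr0 scale1r !mderivn0.
have mderivnDn (i : 'I_2) : P^`M(i, j.+1.*2) = P^`M(i, j.*2)^`M(i, 2).
  by rewrite doubleS !mderivnS mderivn0.
have comm : P^`M(ord_max, j.*2)^`M(ord0, 2) = P^`M(ord0, 2)^`M(ord_max, j.*2).
  by rewrite -!mderivmDm addmC.
have -> : P^`M(ord_max, j.+1.*2) = - P^`M(ord0, 2)^`M(ord_max, j.*2).
  have := sum2 2 P; rewrite harmP => /esym/eqP; rewrite addr_eq0 => /eqP ->.
  by rewrite mderivmN opprK mderivnDn -!mderivmDm addmC.
by rewrite mderivnDn IH mderivmZ comm exprS mulN1r scaleNr scalerN opprK.
Qed.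

Section ThetaSeries.
Context {R : numDomainType} {n : nat}.
Implicit Types (e : bool) (P Q : {mpoly R[n]}) (m : 'X_{1..n}).

Definition theta_series e P : fps R :=
  Fps (fun N =>
    \sum_(k : {ffun 'I_n -> 'I_(window_size e N)}
           | (\sum_i `|window_elt e N (k i)| ^ 2 == N)%N)
       P.@[fun i => (window_elt e N (k i))%:~R]).

Arguments theta_series : simpl never.

Lemma theta_series_is_linear e : linear (theta_series e).
Proof.
move=> c P Q; apply/fpsP => N; rewrite /theta_series /= mulr_sumr -big_split.
by apply: eq_bigr => k _; rewrite mevalD mevalZ.
Qed.

HB.instance Definition _ e :=
  GRing.isLinear.Build R {mpoly R[n]} (fps R) *:%R (theta_series e)
    (theta_series_is_linear e).

Lemma theta_seriesX e m : theta_series e 'X_[m] = \prod_i theta_moment e (m i).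
Proof.
apply/fpsP => N; rewrite (@prod_theta_moment _ n e m N); last by nia.
by apply: eq_bigr => k _; rewrite mevalX.
Qed.

Lemma theta_seriesE e P :
  theta_series e P = \sum_(m <- msupp P) P@_m *: \prod_i theta_moment e (m i).
Proof.
rewrite {1}[P]mpolyE linear_sum; apply: eq_bigr => m _.
by rewrite linearZZ /= theta_seriesX.
Qed.

Lemma theta_series_window e P B N : (N <= B.*2 ^ 2)%N ->
  theta_series e P N =
  \sum_(k : {ffun 'I_n -> 'I_(window_size e B)}
         | (\sum_i `|window_elt e B (k i)| ^ 2 == N)%N)
     P.@[fun i => (window_elt e B (k i))%:~R].
Proof.
move=> leN; rewrite theta_seriesE fps_sum.
under eq_bigr do rewrite fpsZ (prod_theta_moment _ _ leN) mulr_sumr.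
by rewrite exchange_big; apply: eq_bigr => k _; rewrite mevalE.
Qed.

Lemma theta_seriesC e c : theta_series e c%:MP = c *: theta e ^+ n.
Proof.
rewrite -[c%:MP]mulr1 -[1]mpolyX0 mul_mpolyC linearZZ /= theta_seriesX.
by under eq_bigr do rewrite mnm0E; rewrite prodr_const card_ord.
Qed.

Lemma theta_seriesX_mderivn e m i k : theta_series e 'X_[m]^`M(i, k) =
  ((m i) ^_ k)%:R * theta_moment e (m i - k)%N * \prod_(j | j != i) theta_moment e (m j).
Proof.
rewrite mderivnX linearZZ /= theta_seriesX scaler_nat -[LHS]mulr_natl -mulrA; congr (_ * _).
rewrite (bigD1 i) //= mnmBE mulmnE mnm1E eqxx mul1n; congr (_ * _).
by apply: eq_bigr => j neji; rewrite mnmBE mulmnE mnm1E eq_sym (negbTE neji) subn0.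
Qed.

End ThetaSeries.

Section HarmonicTheta.
Context {R : numDomainType} (n : nat) (e : bool).
Implicit Types P : {mpoly R[n]}.

Local Notation T := (@theta R e).
Local Notation f := (@theta_moment R e).
Local Notation Lambda := (@theta_series R n e).

(* Gaussian moments satisfy [f k = (k - 1) * f 2 * f (k - 2)] up to powers of
   [f 0]; the two other terms are the cumulant corrections to this. *)
Lemma theta_moment_recurrence k : (k <= 6)%N ->
  120 * k%:R * T ^+ 3 * f k =
    120 * T ^+ 2 * xderiv T * ((k ^_ 2)%:R * f (k - 2)%N)
    + 20 * T * rankin_cohen 3 T * ((k ^_ 4)%:R * f (k - 4)%N)
    + cumulant6 T * ((k ^_ 6)%:R * f (k - 6)%N).
Proof.
have f2 : f 2 = xderiv T by rewrite theta_momentSS.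
have f4 : f 4 = xderiv (xderiv T) by rewrite theta_momentSS f2.
have f6 : f 6 = xderiv (xderiv (xderiv T)) by rewrite theta_momentSS f4.
move=> lek6; have [oddk|] := boolP (odd k).
  have term0 j : ~~ odd j -> (k ^_ j)%:R * f (k - j)%N = 0.
    move=> evj; have [lejk|ltkj] := leqP j k; last by rewrite ffact_small // mul0r.
    by rewrite theta_moment_odd ?mulr0 // oddB // oddk (negbTE evj).
  by rewrite !term0 // theta_moment_odd // !mulr0 !addr0.
case: k lek6 => [|[|[|[|[|[|[|//]]]]]]] // _ _.
- by rewrite !mul0r !mulr0 !mul0r !addr0.
- by rewrite (_ : 2 ^_ 2 = 2)%N // f2 -/(theta e) !mul0r !mulr0 !addr0; ring.
- rewrite (_ : 4 ^_ 2 = 12)%N // (_ : 4 ^_ 4 = 24)%N // f4 f2 -/(theta e) /rankin_cohen.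
  by rewrite !mul0r mulr0 addr0; ring.
- rewrite (_ : 6 ^_ 2 = 30)%N // (_ : 6 ^_ 4 = 360)%N // (_ : 6 ^_ 6 = 720)%N //.
  by rewrite f6 f4 f2 -/(theta e) /rankin_cohen /cumulant6; ring.
Qed.

Lemma theta_seriesX_recurrence (m : 'X_{1..n}) : (mdeg m <= 6)%N ->
  120 * (mdeg m)%:R * T ^+ 3 * Lambda 'X_[m] =
    120 * T ^+ 2 * xderiv T * Lambda (sum_mderivn 2 'X_[m])
    + 20 * T * rankin_cohen 3 T * Lambda (sum_mderivn 4 'X_[m])
    + cumulant6 T * Lambda (sum_mderivn 6 'X_[m]).
Proof.
move=> lem6; transitivity (\sum_i 120 * (m i)%:R * T ^+ 3 * Lambda 'X_[m]).
  by rewrite -!mulr_suml -mulr_sumr -natr_sum -mdegE.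
rewrite !linear_sum !mulr_sumr -!big_split.
apply: eq_bigr => i _ /=; rewrite !theta_seriesX_mderivn theta_seriesX (bigD1 i) //=.
set W := \prod_(j | _) _.
have lei6 : (m i <= 6)%N.
  by apply: leq_trans lem6; rewrite mdegE (bigD1 i) //= leq_addr.
transitivity (W * (120 * (m i)%:R * T ^+ 3 * f (m i))); first by ring.
by rewrite theta_moment_recurrence //; ring.
Qed.

(* Gaussian integration by parts with its cumulant corrections: the Laplacian
   absorbs the whole Gaussian part. *)
Lemma theta_series_recurrence P d : P \is d.-homog -> (d <= 6)%N ->
  120 * d%:R * T ^+ 3 * Lambda P =
    120 * T ^+ 2 * xderiv T * Lambda (sum_mderivn 2 P)
    + 20 * T * rankin_cohen 3 T * Lambda (sum_mderivn 4 P)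
    + cumulant6 T * Lambda (sum_mderivn 6 P).
Proof.
move=> homP led6.
have derivE k : Lambda (sum_mderivn k P) =
    \sum_(m <- msupp P) P@_m *: Lambda (sum_mderivn k 'X_[m]).
  rewrite {1}[P]mpolyE (linear_sum (sum_mderivn k)) linear_sum.
  by apply: eq_bigr => m _; rewrite !linearZZ.
rewrite !derivE {1}[P]mpolyE linear_sum !mulr_sumr -!big_split.
apply: eq_big_seq => m mP; rewrite !linearZZ /= -!scalerAr -!scalerDr; congr (_ *: _).
by rewrite -(dhomog_mf homP mP) theta_seriesX_recurrence // (dhomog_mf homP mP).
Qed.

Definition harmonic_form4 : fps R :=
  T ^+ n * theta (~~ e) ^+ 4 * (T ^+ 4 - theta (~~ e) ^+ 4).

Definition harmonic_form6 : fps R := harmonic_form4 * (T ^+ 4 - 2 * theta (~~ e) ^+ 4).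

Lemma theta_series_harmonic2 P : P \is 2.-homog -> sum_mderivn 2 P = 0 -> Lambda P = 0.
Proof.
move=> homP harmP; have := theta_series_recurrence homP isT.
rewrite harmP !(sum_mderivn_eq0 homP) // !linear0 !mulr0 !addr0 => /eqP.
have nz_c : 120 * 2 * T ^+ 3 != 0.
  by rewrite !mulf_neq0 ?expf_neq0 ?theta_neq0 ?fps_natr_neq0.
by rewrite mulf_eq0 (negbTE nz_c) => /eqP.
Qed.

Lemma theta_series_harmonic4 P : P \is 4.-homog -> sum_mderivn 2 P = 0 ->
  12 * Lambda P = (sum_mderivn 4 P)@_0 *: harmonic_form4.
Proof.
move=> homP harmP; have := theta_series_recurrence homP isT.
rewrite harmP (sum_mderivn_eq0 (k := 6) homP) // !linear0 !mulr0 addr0 add0r.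
rewrite (@dhomog0_const _ _ (sum_mderivn 4 P)) ?dhomog_sum_mderivn // theta_seriesC.
rewrite mcoeffC eqxx mulr1 theta_rankin_cohen /harmonic_form4 -!scalerAr => eqP4.
have nz_c : 40 * T ^+ 3 != 0.
  by rewrite mulf_neq0 ?expf_neq0 ?theta_neq0 ?fps_natr_neq0.
apply: (mulfI nz_c); rewrite -scalerAr.
transitivity (120 * 4 * T ^+ 3 * Lambda P); first by ring.
by rewrite eqP4; congr (_ *: _); ring.
Qed.

Lemma theta_series_harmonic6 P : P \is 6.-homog -> sum_mderivn 2 P = 0 ->
  90 * Lambda P = (sum_mderivn 6 P)@_0 *: harmonic_form6.
Proof.
move=> homP harmP; have := theta_series_recurrence homP isT.
rewrite harmP (theta_series_harmonic2 (dhomog_sum_mderivn (k := 4) (d := 2) homP)); last first.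
  by rewrite sum_mderivnC harmP linear0.
rewrite linear0 !mulr0 !add0r.
rewrite (@dhomog0_const _ _ (sum_mderivn 6 P)) ?dhomog_sum_mderivn // theta_seriesC.
rewrite mcoeffC eqxx mulr1 theta_cumulant6 /harmonic_form6 /harmonic_form4 -!scalerAr => eqP6.
have nz_c : 8 * T ^+ 3 != 0.
  by rewrite mulf_neq0 ?expf_neq0 ?theta_neq0 ?fps_natr_neq0.
apply: (mulfI nz_c); rewrite -scalerAr.
transitivity (120 * 6 * T ^+ 3 * Lambda P); first by ring.
by rewrite eqP6; congr (_ *: _); ring.
Qed.

End HarmonicTheta.

Lemma theta_series_plane_harmonic6 (R : numDomainType) e (P : {mpoly R[2]}) :
  P \is 6.-homog -> sum_mderivn 2 P = 0 -> theta_series e P = 0.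
Proof.
move=> homP harmP; apply: (mulfI (fps_natr_neq0 R 89)).
rewrite mulr0 theta_series_harmonic6 //.
by rewrite (sum_mderivn_plane_eq0 (k := 3) harmP isT) mcoeff0 scale0r.
Qed.

(** * Vanishing coefficients *)

Section Dissection.
Context {R : numDomainType}.

Local Notation A := (@theta R false).
Local Notation B := (@theta R true).
Local Notation S := (@theta_sum R).
Local Notation C := (@theta_prod R).
Local Notation D := (@theta_disc R).
Local Notation P := (A ^+ 4 * B ^+ 4).
Local Notation V := (A ^+ 4 - B ^+ 4).

Lemma theta_even_fpsXn : A \in fpsXn 4.
Proof. exact/fpsXnP/supported_theta_even. Qed.

Lemma supported4_theta_odd : supported 4 1 B.
Proof. exact: (@supportedW _ 8) supported_theta_odd. Qed.

Lemma theta_odd_X4_fpsXn : B ^+ 4 \in fpsXn 4.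
Proof.
apply/fpsXnP/(@supported_eqmod _ 4 (4 * 1)%N 0) => //.
exact: supportedX supported4_theta_odd.
Qed.

Lemma theta_sum_fpsXn : S \in fpsXn 4.
Proof. by rewrite rpredD ?theta_odd_X4_fpsXn ?rpredX ?theta_even_fpsXn. Qed.

Lemma theta_X4B_fpsXn : V \in fpsXn 4.
Proof. by rewrite rpredB ?theta_odd_X4_fpsXn ?rpredX ?theta_even_fpsXn. Qed.

Definition fpsXn_theta :=
  (theta_odd_X4_fpsXn, theta_even_fpsXn, theta_X4B_fpsXn, theta_sum_fpsXn).

Lemma supported_theta_prod : supported 4 2 C.
Proof.
have B2 : supported 4 (2 * 1)%N (B ^+ 2) := supportedX supported4_theta_odd.
by rewrite /theta_prod mulrC; apply: supportedMr B2 _; rewrite rpredX ?theta_even_fpsXn.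
Qed.

Lemma theta_even_dil2 : A = dil (dil (A + B)).
Proof.
have sqE : A ^+ 2 == dil (dil (A + B)) ^+ 2.
  rewrite -!rmorphXn {1}theta_even_sqr {1}theta_odd_sqr {1}theta_even_sqr -!rmorphD.
  by apply/eqP; congr (dil (dil _)); ring.
move: sqE; rewrite eqf_sqr => /orP[/eqP //|/eqP A_opp].
have /eqP := congr1 (fun s : fps R => s 0%N) A_opp.
rewrite fpsN !(fps_dil_double _ 0) fpsD theta_even0 vanishes_below_theta_odd // addr0.
by rewrite -addr_eq0 -mulr2n pnatr_eq0.
Qed.

Lemma theta_odd_X4_dil2 : B ^+ 4 = dil (dil (8 * A * B * (A ^+ 2 + B ^+ 2))).
Proof.
rewrite theta_odd_X4 /theta_prod {1}theta_odd_sqr {1}theta_even_sqr -(rmorph_nat dil) -!rmorphM.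
by congr (dil (dil _)); ring.
Qed.

Lemma theta_X4B_dil2 : V = dil (dil ((A - B) ^+ 4)).
Proof.
have -> : V = dil ((A ^+ 2 - B ^+ 2) ^+ 2).
  by rewrite theta_X4B /theta_sum /theta_prod; congr dil; ring.
rewrite {1}theta_odd_sqr {1}theta_even_sqr -rmorphB -rmorphXn.
by congr (dil (dil _)); ring.
Qed.

Lemma supported_harmonic_form4_Z4 : supported 8 4 (@harmonic_form4 R 4 false).
Proof.
rewrite -[harmonic_form4 _ _]/D theta_disc_dil; apply: (@supported_dil _ 4 2).
rewrite -mulrA mulrCA; apply: supportedMr supported_theta_prod _.
by rewrite rpredM ?rpred_nat ?rpredX ?theta_X4B_fpsXn.
Qed.

Lemma harmonic_form4_ShS n : harmonic_form4 n.+4 true = - (B ^+ n * D).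
Proof. by rewrite /harmonic_form4 /theta_disc /= -addn4 exprD; ring. Qed.

Lemma theta_odd_X12_disc : B ^+ 12 * D = dil (256 * D ^+ 2).
Proof.
rewrite (exprM B 4 3) {1}theta_disc_dil {1}theta_odd_X4 -rmorphXn -rmorphM; congr dil.
by rewrite /theta_prod /theta_disc; ring.
Qed.

Lemma supported_harmonic_form4_Sh16 : supported 16 0 (@harmonic_form4 R 16 true).
Proof.
apply/fpsXnP; rewrite harmonic_form4_ShS theta_odd_X12_disc rpredN; apply/fpsXnP.
apply: (@supported_dil _ 8 0); apply/fpsXnP; rewrite rpredM ?rpred_nat //; apply/fpsXnP.
exact: (@supported_eqmod _ 8 (2 * 4)%N 0 _ erefl (supportedX supported_harmonic_form4_Z4)).
Qed.

(* [theta_even_dil2], [theta_odd_X4_dil2] and [theta_X4B_dil2] express the left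
   side as the dilation of a polynomial in [A] and [B], whose terms are sorted
   by their degree in [B] modulo 4. *)
Lemma harmonic_form4_Z7_dil2 (h := harmonic_form4 7 false) :
  h = dil (dil (64 * (B ^+ 3 * D - h)
    + B * (8 * A * V * (A ^+ 9 - 6 * A ^+ 5 * B ^+ 4 - 3 * A * (B ^+ 4) ^+ 2))
    + B ^+ 2 * (8 * A * V * (3 * A ^+ 8 + 6 * P - (B ^+ 4) ^+ 2)))).
Proof.
transitivity (dil (dil ((A + B) ^+ 7 * (8 * A * B * (A ^+ 2 + B ^+ 2)) * (A - B) ^+ 4))).
  rewrite /h /harmonic_form4 theta_X4B_dil2 theta_odd_X4_dil2 {1}theta_even_dil2.
  by rewrite -!rmorphXn -!rmorphM.
by congr (dil (dil _)); rewrite /h /harmonic_form4 /theta_disc; ring.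
Qed.

Lemma harmonic_form4_Z7_mul4 (h := harmonic_form4 7 false) N :
  N != 1 %[mod 4] -> N != 2 %[mod 4] -> h (4 * N)%N = 64 * ((B ^+ 3 * D) N - h N).
Proof.
move=> N1 N2; rewrite (_ : 4 * N = N.*2.*2)%N; last by lia.
rewrite {1}/h harmonic_form4_Z7_dil2 -/h !fps_dil_double !fpsD fps_natM fpsD fpsN.
have B2 : supported 4 (2 * 1)%N (B ^+ 2) := supportedX supported4_theta_odd.
rewrite (supported_eq0 (supportedMr supported4_theta_odd _) N1) ?addr0; last first.
  by rewrite !(fpsXn_theta, rpred_nat, rpredM, rpredB, rpredX).
rewrite (supported_eq0 (supportedMr B2 _) N2) ?addr0 //.
by rewrite !(fpsXn_theta, rpred_nat, rpredM, rpredB, rpredD, rpredX).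
Qed.

Lemma harmonic_form4_Z7_eq0 a b : harmonic_form4 7 false (4 ^ a * (32 * b + 12))%N = 0 :> R.
Proof.
have supp_h : supported 4 0 (@harmonic_form4 R 7 false).
  by apply/fpsXnP; rewrite /harmonic_form4 !(fpsXn_theta, rpredM, rpredX).
have supp_BD : supported 8 (3 * 1 + 4) (B ^+ 3 * D).
  exact: supportedM (supportedX supported_theta_odd) supported_harmonic_form4_Z4.
elim: a => [|a IH].
  rewrite (_ : 4 ^ 0 * _ = 4 * (8 * b + 3))%N; last by lia.
  rewrite harmonic_form4_Z7_mul4; [| by lia | by lia].
  by rewrite (supported_eq0 supp_BD) ?(supported_eq0 supp_h) ?subrr ?mulr0 //; lia.
have dvd4 : (4 %| 4 ^ a * (32 * b + 12))%N by rewrite dvdn_mull //; lia.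
rewrite expnS -mulnA harmonic_form4_Z7_mul4 ?(eqP dvd4) // IH.
by rewrite (supported_eq0 (@supportedW _ 8 4 _ _ isT supp_BD)) ?subr0 ?mulr0 // (eqP dvd4).
Qed.

(* Dilation of a polynomial in [S] and [C]: since [C] lives on exponents 2 mod 4,
   only its even part in [C] contributes to exponents 0 mod 8. *)
Lemma dil_even_part s g h k N :
  s = dil (k%:R * (g + C * h)) -> h \in fpsXn 4 -> (4 %| N)%N -> s N.*2 = k%:R * g N.
Proof.
move=> -> hX4 dvdN; rewrite fps_dil_double fps_natM fpsD.
rewrite (supported_eq0 (supportedMr supported_theta_prod hX4)) ?addr0 //.
by rewrite (eqP dvdN).
Qed.

Definition theta_dilE :=
  (@theta_even_X4 R, @theta_odd_X4 R, @theta_X4B R, @theta_X4D R).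

Lemma theta_disc_sqr_sum_mul4 (G := D ^+ 2 * S) N :
  (4 %| N)%N -> G (4 * N)%N = 4096 * G N.
Proof.
move=> dvdN; rewrite (_ : 4 * N = N.*2.*2)%N; last by lia.
pose H := P * V ^+ 4 * S.
have HE : H = dil (4 * (64 * G + C * (V ^+ 2 * (S ^+ 4 - 24 * P * S ^+ 2
    - 48 * P ^+ 2)))).
  transitivity (dil (S + 2 * C) * dil (4 * C) * dil (S - 2 * C) ^+ 4 * dil (S + 6 * C)).
    by rewrite -!theta_dilE.
  rewrite -!(rmorphXn, rmorphM) /G /theta_disc /theta_sum /theta_prod.
  by congr dil; ring.
have GE : G = dil (16 * (H + C * (6 * P * V ^+ 4))).
  transitivity ((dil (S + 2 * C) * dil (4 * C) * dil (S - 2 * C)) ^+ 2 * dil (S + 6 * C)).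
    by rewrite -!theta_dilE.
  rewrite -!(rmorphXn, rmorphM) /H /theta_sum /theta_prod.
  by congr dil; ring.
rewrite (dil_even_part GE) ?(dil_even_part HE) // ?fps_natM.
- by ring.
- by rewrite !(fpsXn_theta, rpred_nat, rpredM, rpredB, rpredX).
- by rewrite !(fpsXn_theta, rpred_nat, rpredM, rpredX).
by lia.
Qed.

Lemma theta_disc_sqr_sum_eq0 a : (D ^+ 2 * S) (4 ^ a.+1)%N = 0.
Proof.
elim: a => [|a IH]; last by rewrite expnS theta_disc_sqr_sum_mul4 ?IH ?mulr0 // expnS dvdn_mulr.
have -> : D ^+ 2 * S = B ^+ 8 * (A ^+ 8 * V ^+ 2 * S).
  by rewrite /theta_disc; ring.
by rewrite (vanishes_belowMr _ (vanishes_belowX (n := 8) vanishes_below_theta_odd)).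
Qed.

Lemma harmonic_form6_Z16_eq0 a : harmonic_form6 16 false (8 * 4 ^ a)%N = 0 :> R.
Proof.
rewrite (_ : 8 * 4 ^ a = (4 ^ a.+1).*2)%N; last by rewrite expnS; lia.
have formE : harmonic_form6 16 false = dil (4 * (- (64 * (D ^+ 2 * S)) + C * (V ^+ 2
    * (S ^+ 4 - 24 * P * S ^+ 2 - 48 * P ^+ 2)))).
  transitivity (dil (S + 2 * C) ^+ 4 * dil (4 * C) * dil (S - 2 * C)
    * (dil (S + 2 * C) - dil 2 * dil (4 * C))).
    by rewrite rmorph_nat -!theta_dilE -exprM.
  rewrite -!(rmorphXn, rmorphM, rmorphB) /theta_disc /theta_sum /theta_prod.
  by congr dil; ring.
rewrite (dil_even_part formE) ?fpsN ?fps_natM ?theta_disc_sqr_sum_eq0 ?mulr0 ?oppr0 ?mulr0 //.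
- by rewrite !(fpsXn_theta, rpred_nat, rpredM, rpredB, rpredX).
by rewrite expnS dvdn_mulr.
Qed.

Lemma harmonic_form6_ShS n : harmonic_form6 n.+4 true = - (B ^+ n * D) * (B ^+ 4 - 2 * A ^+ 4).
Proof. by rewrite /harmonic_form6 harmonic_form4_ShS. Qed.

Lemma harmonic_form6_Sh16 : harmonic_form6 16 true = dil (512 * (D ^+ 2 * S)).
Proof.
rewrite harmonic_form6_ShS theta_odd_X12_disc.
transitivity (- dil (256 * D ^+ 2) * (dil (4 * C) - dil 2 * dil (S + 2 * C))).
  by rewrite rmorph_nat -!theta_dilE.
rewrite -rmorphN -!(rmorphM, rmorphB); congr dil.
by ring.
Qed.

Lemma harmonic_form6_Sh16_eq0 a : harmonic_form6 16 true (8 * 4 ^ a)%N = 0 :> R.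
Proof.
rewrite (_ : 8 * 4 ^ a = (4 ^ a.+1).*2)%N; last by rewrite expnS; lia.
by rewrite harmonic_form6_Sh16 fps_dil_double fps_natM theta_disc_sqr_sum_eq0 mulr0.
Qed.

(* Up to scalars, the coefficient of [harmonic_form6 40 true] at 96 is that of
   these three forms at 48, 24 and 12. *)
Definition Sh40_form48 : fps R := P ^+ 3 * (D ^+ 2 * S).
Definition Sh40_form24 : fps R := P ^+ 3 * V ^+ 4 * S * (3 * S ^+ 2 + 20 * P).
Definition Sh40_form12 : fps R := P ^+ 2 * V ^+ 6 * S * (2 * S ^+ 2 - 5 * P).

Lemma harmonic_form6_Sh40 : harmonic_form6 40 true = dil (4096 * (512 * Sh40_form48)).
Proof.
transitivity (dil (4 * C) ^+ 6 * harmonic_form6 16 true).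
  by rewrite -theta_dilE !harmonic_form6_ShS; ring.
rewrite harmonic_form6_Sh16 -rmorphXn -rmorphM /Sh40_form48 /theta_prod; congr dil.
by ring.
Qed.

Lemma Sh40_form48_double N : (4 %| N)%N -> Sh40_form48 N.*2 = 4096 * Sh40_form24 N.
Proof.
have formE : Sh40_form48 = dil (1024 * (4 * Sh40_form24
    + C * (P ^+ 2 * V ^+ 4 * (S ^+ 4 + 48 * P * S ^+ 2 + 48 * P ^+ 2)))).
  transitivity ((dil (S + 2 * C) * dil (4 * C)) ^+ 5 * dil (S - 2 * C) ^+ 2 * dil (S + 6 * C)).
    by rewrite -!theta_dilE /Sh40_form48 /theta_disc /theta_sum; ring.
  rewrite -!(rmorphXn, rmorphM) /Sh40_form24 /theta_sum /theta_prod; congr dil.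
  by ring.
move=> dvdN; rewrite (dil_even_part formE) // ?fps_natM; first by ring.
by rewrite !(fpsXn_theta, rpred_nat, rpredM, rpredD, rpredX).
Qed.

Lemma Sh40_form24_double N : (4 %| N)%N -> Sh40_form24 N.*2 = 4096 * Sh40_form12 N.
Proof.
have formE : Sh40_form24 = dil (64 * (64 * Sh40_form12
    + C * (P * V ^+ 6 * (3 * S ^+ 4 + 696 * P * S ^+ 2 - 3216 * P ^+ 2)))).
  transitivity ((dil (S + 2 * C) * dil (4 * C)) ^+ 3 * dil (S - 2 * C) ^+ 4 * dil (S + 6 * C)
      * (dil 3 * dil (S + 6 * C) ^+ 2 + dil 20 * (dil (S + 2 * C) * dil (4 * C)))).
    by rewrite !rmorph_nat -!theta_dilE.
  rewrite -!(rmorphXn, rmorphM, rmorphD) /Sh40_form12 /theta_sum /theta_prod; congr dil.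
  by ring.
move=> dvdN; rewrite (dil_even_part formE) // ?fps_natM; first by ring.
by rewrite !(fpsXn_theta, rpred_nat, rpredM, rpredB, rpredD, rpredX).
Qed.

(* The term linear in [C] cancels, and [C ^+ 4] has no coefficients below 8. *)
Lemma Sh40_form12_eq0 : Sh40_form12 12%N = 0.
Proof.
have -> : Sh40_form12 = dil (16 * (2 * P * V ^+ 4 * S ^+ 7 + B ^+ 8 * (A ^+ 8 * V ^+ 4
    * (- 24 * S ^+ 5 + 64 * S ^+ 4 * C - 672 * S ^+ 3 * C ^+ 2 + 3072 * S ^+ 2 * C ^+ 3
       - 5248 * S * C ^+ 4 + 3072 * C ^+ 5)))).
  transitivity ((dil (S + 2 * C) * dil (4 * C)) ^+ 2 * dil (S - 2 * C) ^+ 6 * dil (S + 6 * C)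
      * (dil 2 * dil (S + 6 * C) ^+ 2 - dil 5 * (dil (S + 2 * C) * dil (4 * C)))).
    by rewrite !rmorph_nat -!theta_dilE.
  rewrite -!(rmorphXn, rmorphM, rmorphB) /theta_sum /theta_prod; congr dil.
  by ring.
have evenX4 : 2 * P * V ^+ 4 * S ^+ 7 \in fpsXn 4.
  by rewrite !(fpsXn_theta, rpred_nat, rpredM, rpredX).
rewrite (fps_dil_double _ 6) fps_natM fpsD (supported_eq0 (fpsXnP _ _ evenX4)) // add0r.
by rewrite (vanishes_belowMr _ (vanishes_belowX (n := 8) vanishes_below_theta_odd)) ?mulr0.
Qed.

Lemma harmonic_form6_Sh40_eq0 : harmonic_form6 40 true 96%N = 0 :> R.
Proof.
rewrite harmonic_form6_Sh40 (fps_dil_double _ 48) !fps_natM (Sh40_form48_double (N := 24)) //.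
by rewrite (Sh40_form24_double (N := 12)) // Sh40_form12_eq0 !mulr0.
Qed.

End Dissection.
(** * Lagrange's four-square theorem *)

Definition sum4sq (n : int) : Prop :=
  exists a b c d : int, n = a ^+ 2 + b ^+ 2 + c ^+ 2 + d ^+ 2.

Lemma sum4sqM m n : sum4sq m -> sum4sq n -> sum4sq (m * n).
Proof.
move=> [a [b [c [d ->]]]] [a' [b' [c' [d' ->]]]].
exists (a * a' + b * b' + c * c' + d * d'), (a * b' - b * a' + c * d' - d * c').
exists (a * c' - c * a' + d * b' - b * d'), (a * d' - d * a' + b * c' - c * b').
by ring.
Qed.

Lemma sum4sq_half n : sum4sq (2 * n) -> sum4sq n.
Proof.
have pairs a b c d : (2 %| a + b)%Z -> (2 %| c + d)%Z ->
    2 * n = a ^+ 2 + b ^+ 2 + c ^+ 2 + d ^+ 2 -> sum4sq n.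
  move=> /dvdzP[u ab] /dvdzP[v cd] nE; exists u, (u - b), v, (v - d).
  have [aE cE] : a = u * 2 - b /\ c = v * 2 - d by split; lia.
  by apply: (@mulfI _ 2) => //; rewrite nE aE cE; ring.
have sqrE (x : int) : exists q, x ^+ 2 = x + 2 * q.
  have [k [->|->]] : exists k, x = 2 * k \/ x = 2 * k + 1 by exists (x %/ 2)%Z; lia.
    by exists (2 * k ^+ 2 - k); ring.
  by exists (2 * k ^+ 2 + k); ring.
move=> [a [b [c [d nE]]]].
have [qa aE] := sqrE a; have [qb bE] := sqrE b; have [qc cE] := sqrE c; have [qd dE] := sqrE d.
have even_sum : (2 %| a + b + (c + d))%Z by lia.
have [ab|nab] := boolP (2 %| a + b)%Z; first by apply: (pairs a b c d) => //; lia.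
have [ac|nac] := boolP (2 %| a + c)%Z; first by apply: (pairs a c b d) => //; lia.
by apply: (pairs a d b c) => //; lia.
Qed.

Lemma centered_edivz (a : int) (m : nat) : odd m ->
  exists b k : int, a = b + m%:Z * k /\ - m%:Z < 2 * b < m%:Z.
Proof.
move=> oddm; have m_neq0 : m%:Z != 0 by lia.
have rm := ltz_mod a m_neq0; have r0 := modz_ge0 a m_neq0.
have := divz_eq a m; move: (a %/ m)%Z (a %% m)%Z rm r0 => q r rm r0 ->.
have [lt2r|le2r] := ltP (2 * r) m%:Z.
  by exists r, q; split; [ring | lia].
by exists (r - m%:Z), (q + 1); split; [ring | lia].
Qed.

Lemma dvdn_sum2sqS p : prime p -> odd p ->
  exists x y : nat, [/\ (x <= p./2)%N, (y <= p./2)%N & (p %| x ^ 2 + y ^ 2 + 1)%N].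
Proof.
move=> p_pr oddp; set h := p./2.
have pE : p = h.*2.+1 by rewrite -[LHS]odd_double_half oddp.
have natr_Fp_eq0 k : (k%:R == 0 :> 'F_p) = (p %| k)%N.
  by rewrite -(dvdn_pcharf (pchar_Fp p_pr)).
pose sq (i : 'I_h.+1) : 'F_p := i%:R ^+ 2.
have sq_inj : injective sq.
  move=> i j /eqP; rewrite -subr_eq0 subr_sqr mulf_eq0 => /orP[|].
    wlog leij : i j / (j <= i)%N => [W|].
      case/orP: (leq_total j i) => [/W //|/W Wij].
      by rewrite -oppr_eq0 opprB => /Wij.
    rewrite -natrB // natr_Fp_eq0 => /dvdn_leq le_p; apply: val_inj => /=.
    by move: (ltn_ord i) (ltn_ord j); lia.
  rewrite -natrD natr_Fp_eq0 => /dvdn_leq le_p; apply: val_inj => /=.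
  by move: (ltn_ord i) (ltn_ord j); lia.
pose X := [set sq i | i : 'I_h.+1]; pose Y := [set - 1 - sq i | i : 'I_h.+1].
have [z] : exists z, z \in X :&: Y.
  apply/set0Pn; rewrite -card_gt0; have := max_card (mem (X :|: Y)).
  rewrite card_Fp // -(leq_add2r #|X :&: Y|) cardsUI !card_imset ?card_ord //.
    by rewrite [X in (_ <= X + _)%N]pE; lia.
  by move=> i j /addrI/oppr_inj/sq_inj.
rewrite inE => /andP[/imsetP[x _ ->] /imsetP[y _ xy]]; exists x, y; split.
- by rewrite -ltnS.
- by rewrite -ltnS.
by rewrite -natr_Fp_eq0 !natrD !natrX -/(sq x) -/(sq y) xy; apply/eqP; ring.
Qed.

Lemma centered_sqr_lt (b m : int) : - m < 2 * b < m -> 4 * b ^+ 2 < m ^+ 2.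
Proof.
move=> bm; rewrite -subr_gt0.
have -> : m ^+ 2 - 4 * b ^+ 2 = (m - 2 * b) * (m + 2 * b) by ring.
by apply: mulr_gt0; lia.
Qed.

(* Euler's identity for the product of the two sums of squares yields four
   multiples of [m]. *)
Lemma sum4sq_residues (m p r b1 b2 b3 b4 k1 k2 k3 k4 : int) : m != 0 ->
    (b1 + m * k1) ^+ 2 + (b2 + m * k2) ^+ 2 + (b3 + m * k3) ^+ 2 + (b4 + m * k4) ^+ 2
      = m * p ->
    b1 ^+ 2 + b2 ^+ 2 + b3 ^+ 2 + b4 ^+ 2 = m * r ->
  sum4sq (r * p).
Proof.
move=> nz_m aE bE; pose bk := b1 * k1 + b2 * k2 + b3 * k3 + b4 * k4.
exists (r + bk), (k1 * b2 - k2 * b1 + k3 * b4 - k4 * b3).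
exists (k1 * b3 - k3 * b1 + k4 * b2 - k2 * b4), (k1 * b4 - k4 * b1 + k2 * b3 - k3 * b2).
apply: (mulfI (expf_neq0 2 nz_m)); transitivity ((m * p) * (m * r)); first by ring.
rewrite -bE -aE.
transitivity ((m * r + m * bk) ^+ 2
  + m ^+ 2 * ((k1 * b2 - k2 * b1 + k3 * b4 - k4 * b3) ^+ 2
  + (k1 * b3 - k3 * b1 + k4 * b2 - k2 * b4) ^+ 2
  + (k1 * b4 - k4 * b1 + k2 * b3 - k3 * b2) ^+ 2)); last by ring.
by rewrite -bE /bk; ring.
Qed.

Lemma sum4sq_descent (p m : nat) : prime p -> odd m -> (1 < m)%N -> (m < p)%N ->
  sum4sq (m%:Z * p%:Z) ->
  exists r : nat, [/\ (0 < r)%N, (r < m)%N & sum4sq (r%:Z * p%:Z)].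
Proof.
move=> p_pr oddm m1 mp [a1 [a2 [a3 [a4 aE]]]].
have m0 : 0 < m%:Z by lia.
have [b1 [k1 [a1E b1m]]] := centered_edivz a1 oddm.
have [b2 [k2 [a2E b2m]]] := centered_edivz a2 oddm.
have [b3 [k3 [a3E b3m]]] := centered_edivz a3 oddm.
have [b4 [k4 [a4E b4m]]] := centered_edivz a4 oddm.
pose K := k1 ^+ 2 + k2 ^+ 2 + k3 ^+ 2 + k4 ^+ 2.
pose r := p%:Z - 2 * (b1 * k1 + b2 * k2 + b3 * k3 + b4 * k4) - m%:Z * K.
have bE : b1 ^+ 2 + b2 ^+ 2 + b3 ^+ 2 + b4 ^+ 2 = m%:Z * r.
  by rewrite /r !mulrBr aE a1E a2E a3E a4E /K; ring.
have r_lt : r < m%:Z.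
  rewrite -(ltr_pM2l m0) -bE -expr2; move: (centered_sqr_lt b1m) (centered_sqr_lt b2m).
  move: (centered_sqr_lt b3m) (centered_sqr_lt b4m).
  by move: (b1 ^+ 2) (b2 ^+ 2) (b3 ^+ 2) (b4 ^+ 2) (m%:Z ^+ 2); clear; lia.
have r_ge0 : 0 <= r by rewrite -(ler_pM2l m0) mulr0 -bE !addr_ge0 ?sqr_ge0.
have r_neq0 : r != 0.
  apply/eqP => r0; move/eqP: bE; rewrite r0 mulr0 !paddr_eq0 ?addr_ge0 ?sqr_ge0 //.
  rewrite !sqrf_eq0 => /andP[/andP[/andP[/eqP b10 /eqP b20] /eqP b30] /eqP b40].
  have pE : p%:Z = m%:Z * K.
    by apply: subr0_eq; rewrite -r0 /r b10 b20 b30 b40; ring.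
  have : (m%:Z %| p%:Z)%Z by rewrite pE dvdz_mulr.
  by move=> /(prime_nt_dvdP p_pr) mE; clear -mE m1 mp; lia.
exists `|r|%N; split; [by clear -r_neq0; lia | by clear -r_lt r_ge0; lia |].
rewrite (gez0_abs r_ge0); rewrite a1E a2E a3E a4E in aE.
exact: sum4sq_residues (lt0r_neq0 m0) (esym aE) bE.
Qed.

Lemma sum4sq_prime p : prime p -> sum4sq p%:Z.
Proof.
move=> p_pr; have [p2|oddp] := even_prime p_pr; first by exists 1, 1, 0, 0; rewrite p2.
have [x [y [lex ley /dvdnP[m mE]]]] := dvdn_sum2sqS p_pr oddp.
have m0 : (0 < m)%N by case: m mE => //; rewrite mul0n addn1.
have mp : (m < p)%N.
  have pE : p = p./2.*2.+1 by rewrite -[LHS]odd_double_half oddp.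
  move: (p./2) lex ley pE => h lex ley pE.
  have : (x ^ 2 <= h ^ 2)%N by rewrite leq_exp2r.
  have : (y ^ 2 <= h ^ 2)%N by rewrite leq_exp2r.
  by rewrite -(ltn_pmul2r (prime_gt0 p_pr)) -mE; have := prime_gt1 p_pr; rewrite pE; nia.
have : sum4sq (m%:Z * p%:Z).
  by exists x%:Z, y%:Z, 1, 0; rewrite -PoszM -mE; ring.
elim/ltn_ind: m m0 mp {mE} => m IH m0 mp sum_mp.
have [m1|m1] := leqP m 1; first by move: sum_mp; rewrite (_ : m = 1%N) ?mul1r //; lia.
have [oddm|/even_halfK mE] := boolP (odd m).
  have [r [r0 rm]] := sum4sq_descent p_pr oddm m1 mp sum_mp.
  by apply: IH => //; apply: ltn_trans mp.
apply: (IH m./2); [by lia | by lia | by lia | apply: sum4sq_half].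
by rewrite mulrA -PoszM mul2n mE.
Qed.

Theorem lagrange_four_squares n : sum4sq n%:Z.
Proof.
elim/ltn_ind: n => -[|[|n]] IH; [by exists 0, 0, 0, 0 | by exists 1, 0, 0, 0 |].
set N := n.+2 in IH *; have p_pr : prime (pdiv N) by exact: pdiv_prime.
have /dvdnP[k NE] := pdiv_dvd N.
have -> : N%:Z = k%:Z * (pdiv N)%:Z by rewrite -PoszM -NE.
apply: sum4sqM; last exact: sum4sq_prime.
apply: IH; move: (prime_gt1 p_pr) NE; move: (pdiv N) => q q1 NE.
by rewrite NE ltn_Pmulr //; case: k NE.
Qed.

(** * Shells *)

Section Shells.
Context {R : realType}.
Implicit Types (m : R) (e : bool).

Definition half_row n e B (k : {ffun 'I_n -> 'I_(window_size e B)}) : 'rV[R]_n :=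
  \row_i ((window_elt e B (k i))%:~R / 2).

Definition shell e n m : seq 'rV[R]_n :=
  let B := box_bound m in
  [seq x <- [seq half_row k | k : {ffun 'I_n -> 'I_(window_size e B)}] | sqnorm x == m].

Lemma window_elt_half e B (j : nat) :
  (window_elt e B j)%:~R / 2 = j%:R - B%:R - e%:R / 2 :> R.
Proof.
rewrite /window_elt rmorphB /= -[_%:~R]/(_%:R) -[(B.*2 + e)%:~R]/(_%:R).
by rewrite natrD -!muln2 !natrM; field.
Qed.

Lemma shellZE n m : shellZ n m = shell false n m.
Proof.
congr filter; apply: eq_map => k; apply/rowP => i.
by rewrite !mxE window_elt_half mul0r subr0.
Qed.

Lemma shellShE n m : shellSh n m = shell true n m.
Proof.
congr filter; apply: eq_map => k; apply/rowP => i.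
by rewrite !mxE window_elt_half mul1r.
Qed.

Lemma sqnorm_half_row n e B (k : {ffun 'I_n -> 'I_(window_size e B)}) :
  4 * sqnorm (half_row k) = (\sum_i `|window_elt e B (k i)| ^ 2)%N%:R.
Proof.
rewrite /sqnorm mulr_sumr natr_sum; apply: eq_bigr => i _.
by rewrite mxE natr_absz_sqr exprMn; field.
Qed.

Lemma sqnorm_half_row_eq n e B (k : {ffun 'I_n -> 'I_(window_size e B)}) m N :
  4 * m = N%:R -> (sqnorm (half_row k) == m) = (\sum_i `|window_elt e B (k i)| ^ 2 == N)%N.
Proof.
move=> mN; rewrite -(inj_eq (mulfI (_ : 4 != 0 :> R))) ?pnatr_eq0 //.
by rewrite sqnorm_half_row mN eqr_nat.
Qed.

Lemma box_bound_norm m N : 4 * m = N%:R -> (N <= (box_bound m).*2 ^ 2)%N.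
Proof.
move=> mN; have : (N < 4 * box_bound m)%N.
  by rewrite -(ltr_nat R) -mN natrM ltr_pM2l // /box_bound truncnS_gt.
by rewrite /box_bound; nia.
Qed.

Lemma theta_series_shell e n m N d (P : {mpoly R[n]}) : 4 * m = N%:R -> P \is d.-homog ->
  theta_series e P N = 2 ^+ d * \sum_(x <- shell e n m) evalp P x.
Proof.
move=> mN homP; rewrite (theta_series_window _ _ (box_bound_norm mN)).
rewrite /shell big_filter big_map big_enum_cond /= mulr_sumr.
apply: eq_big => [k|k _]; first by rewrite (sqnorm_half_row_eq _ mN).
rewrite /evalp -(meval_dhomog _ _ homP); apply: meval_eq => i.
by rewrite mxE mulrCA divff ?pnatr_eq0 // mulr1.
Qed.

Lemma shell_norm e n m : shell e n m != [::] -> exists N : nat, 4 * m = N%:R.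
Proof.
case shellE: (shell e n m) => [//|x s] _.
have : x \in shell e n m by rewrite shellE mem_head.
rewrite mem_filter => /andP[/eqP <- /mapP[k _ ->]].
by rewrite sqnorm_half_row; eexists.
Qed.

Lemma harmonic_sum_mderivn n (P : {mpoly R[n]}) : harmonic P -> sum_mderivn 2 P = 0.
Proof. by move=> /eqP <-; apply: eq_bigr => i _; rewrite mderivn_iter. Qed.

Lemma cond_C_shell e n m d :
    (forall (N : nat) (P : {mpoly R[n]}), 4 * m = N%:R -> P \is d.-homog ->
       sum_mderivn 2 P = 0 -> theta_series e P N = 0) ->
  cond_C (shell e n m) d.
Proof.
move=> vanish; have [->|/shell_norm[N mN]] := eqVneq (shell e n m) [::].
  by move=> P _ _; rewrite big_nil.
move=> P homP /harmonic_sum_mderivn/(vanish N P mN homP).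
rewrite (theta_series_shell e mN homP) => /eqP.
by rewrite mulf_eq0 expf_eq0 pnatr_eq0 andbF => /eqP.
Qed.

Lemma cond_C_shell_coef e n m N d k (F : fps R) : 4 * m = N%:R -> F N = 0 ->
    (forall P : {mpoly R[n]}, P \is d.-homog -> sum_mderivn 2 P = 0 ->
       exists c, k.+1%:R * theta_series e P = c *: F) ->
  cond_C (shell e n m) d.
Proof.
move=> mN FN0 multF; apply: cond_C_shell => N' P mN' homP harmP.
have -> : N' = N by apply/eqP; rewrite -(eqr_nat R) -mN -mN'.
have [c /(congr1 (fun s : fps R => s N))/eqP] := multF P homP harmP.
by rewrite fps_natM fpsZ FN0 mulr0 mulf_eq0 pnatr_eq0 => /eqP.
Qed.

Lemma cond_C2_shell e n m : cond_C (shell e n m) 2.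
Proof. by apply: cond_C_shell => N P _ homP harmP; rewrite theta_series_harmonic2. Qed.

Lemma cond_C4_shell e n m N : 4 * m = N%:R -> harmonic_form4 n e N = 0 :> R ->
  cond_C (shell e n m) 4.
Proof.
move=> mN formN0; apply: (cond_C_shell_coef mN formN0) => P homP harmP.
by eexists; apply: theta_series_harmonic4.
Qed.

Lemma cond_C6_shell e n m N : 4 * m = N%:R -> harmonic_form6 n e N = 0 :> R ->
  cond_C (shell e n m) 6.
Proof.
move=> mN formN0; apply: (cond_C_shell_coef mN formN0) => P homP harmP.
by eexists; apply: theta_series_harmonic6.
Qed.

Lemma cond_C6_shell_plane e m : cond_C (shell e 2 m) 6.
Proof. by apply: cond_C_shell => N P _ homP harmP; rewrite theta_series_plane_harmonic6. Qed.

Lemma sph_design3_shell e n m : shell e n m != [::] -> sph_design (shell e n m) 3.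
Proof. by move=> nz; split=> // -[|[|j]] // _ _; apply: cond_C2_shell. Qed.

Lemma sph_design_half_shell e n m :
  shell e n m != [::] -> cond_C (shell e n m) 6 -> sph_design_half (shell e n m) 1.
Proof. by move=> nz C6; split=> //; split=> // -[|[|j]] // _ _; apply: cond_C2_shell. Qed.

Lemma sph_design5_shell e n m :
  shell e n m != [::] -> cond_C (shell e n m) 4 -> sph_design (shell e n m) 5.
Proof. by move=> nz C4; split=> // -[|[|[|j]]] // _ _; apply: cond_C2_shell. Qed.

Lemma shell_neq_nil e n m (s : seq int) : size s = n ->
    all (fun y => odd `|y| == e) s -> 4 * m = (\sum_(y <- s) y ^+ 2)%:~R ->
  shell e n m != [::].
Proof.
move=> sz_s odd_s mE; pose N := (\sum_(y <- s) `|y| ^ 2)%N.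
have mN : 4 * m = N%:R.
  rewrite mE rmorph_sum natr_sum; apply: eq_bigr => y _ /=.
  by rewrite natr_absz_sqr rmorphXn.
set B := box_bound m; have window_s y : y \in s -> y \in window e B.
  move=> ys; rewrite mem_window (allP odd_s _ ys) andbT.
  have : (`|y| ^ 2 <= B.*2 ^ 2)%N.
    by apply: leq_trans (box_bound_norm mN); rewrite /N (big_rem _ ys) leq_addr.
  by rewrite leq_exp2r // => /leq_trans; apply; apply: leq_addr.
have index_s (i : 'I_n) : exists k : 'I_(window_size e B), window_elt e B k = s`_i.
  have /window_s/mapP[j] : s`_i \in s by rewrite mem_nth // sz_s.
  by rewrite mem_iota add0n => ltj ->; exists (Ordinal ltj).
have [k kE] := fin_all_exists index_s.
have : half_row [ffun i => k i] \in shell e n m.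
  rewrite mem_filter map_f ?mem_enum // andbT (sqnorm_half_row_eq _ mN) /N (big_nth 0) sz_s.
  by rewrite big_mkord; apply/eqP; apply: eq_bigr => i _; rewrite ffunE kE.
by apply: contraTneq => ->.
Qed.

Lemma shellZ_neq_nil n m (N : nat) : (4 <= n)%N -> 4 * m = (4 * N)%:R ->
  shell false n m != [::].
Proof.
move=> n4 mN; have [a [b [c [d NE]]]] := lagrange_four_squares N.
apply: (@shell_neq_nil _ _ _ ([:: 2 * a; 2 * b; 2 * c; 2 * d] ++ nseq (n - 4) 0)).
- by rewrite size_cat size_nseq /=; lia.
- by rewrite all_cat all_nseq orbT /= !abszM !oddM.
rewrite mN big_cat !big_cons big_nil big_nseq iter_addr_0 expr0n mul0rn /=.
rewrite natrM -[N%:R]/((N%:Z)%:~R) NE -[4%:R]/(4%:~R) -rmorphM; congr _%:~R; ring.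
Qed.

(* [(2 a + 1) ^ 2 + (2 a - 1) ^ 2 = 8 a ^ 2 + 2] *)
Lemma shellSh16_neq_nil m (N : nat) : 4 * m = (8 * N + 16)%:R -> shell true 16 m != [::].
Proof.
move=> mN; have [a [b [c [d NE]]]] := lagrange_four_squares N.
apply: (@shell_neq_nil _ _ _ ([:: 2 * a + 1; 2 * a - 1; 2 * b + 1; 2 * b - 1;
  2 * c + 1; 2 * c - 1; 2 * d + 1; 2 * d - 1] ++ nseq 8 1)) => //.
  by rewrite all_cat all_nseq orbT andbT /=; clear; lia.
rewrite mN big_cat !big_cons !big_nil /=.
rewrite natrD natrM -[N%:R]/((N%:Z)%:~R) NE -[8%:R]/(8%:~R) -[16%:R]/(16%:~R).
by rewrite -rmorphM -rmorphD; congr _%:~R; ring.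
Qed.

Lemma sph_design_half_plane e m : shell e 2 m != [::] -> sph_design_half (shell e 2 m) 1.
Proof. by move=> nz; apply: sph_design_half_shell (cond_C6_shell_plane e m). Qed.

Lemma sph_design_half_shellZ16 m a :
  4 * m = (8 * 4 ^ a)%:R -> sph_design_half (shell false 16 m) 1.
Proof.
move=> mN; apply: sph_design_half_shell; last first.
  exact: cond_C6_shell mN (harmonic_form6_Z16_eq0 a).
by apply: (@shellZ_neq_nil _ _ (2 * 4 ^ a)) => //; rewrite mN mulnA.
Qed.

Lemma sph_design_half_shellSh16 m a : (0 < a)%N ->
  4 * m = (8 * 4 ^ a)%:R -> sph_design_half (shell true 16 m) 1.
Proof.
move=> a0 mN; apply: sph_design_half_shell; last first.
  exact: cond_C6_shell mN (harmonic_form6_Sh16_eq0 a).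
apply: (@shellSh16_neq_nil _ (4 ^ a - 2)); rewrite mN; congr _%:R.
by case: a a0 {mN} => // a _; rewrite expnS; have := expn_gt0 4 a; lia.
Qed.

Lemma sph_design_half_shellSh40 m :
  4 * m = 96%:R -> sph_design_half (shell true 40 m) 1.
Proof.
move=> mN; apply: sph_design_half_shell; last exact: cond_C6_shell mN harmonic_form6_Sh40_eq0.
apply: (@shell_neq_nil _ _ _ (nseq 7 3 ++ nseq 33 1)) => //.
by rewrite mN big_cat !big_nseq !iter_addr_0.
Qed.

Lemma sph_design5_shellZ4 m a : 4 * m = (8 * a)%:R -> sph_design (shell false 4 m) 5.
Proof.
move=> mN; apply: sph_design5_shell.
  by apply: (@shellZ_neq_nil _ _ (2 * a)) => //; rewrite mN mulnA.
by apply: cond_C4_shell mN _; rewrite (supported_eq0 supported_harmonic_form4_Z4) //; lia.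
Qed.

Lemma sph_design5_shellZ7 m a b :
  4 * m = (4 ^ a * (32 * b + 12))%:R -> sph_design (shell false 7 m) 5.
Proof.
move=> mN; apply: sph_design5_shell; last first.
  exact: cond_C4_shell mN (harmonic_form4_Z7_eq0 a b).
apply: (@shellZ_neq_nil _ _ (4 ^ a * (8 * b + 3))) => //; rewrite mN; congr _%:R.
by lia.
Qed.

Lemma sph_design5_shellSh16 m a : (0 < a)%N ->
  4 * m = (16 * a + 8)%:R -> sph_design (shell true 16 m) 5.
Proof.
move=> a0 mN; apply: sph_design5_shell.
  by apply: (@shellSh16_neq_nil _ (2 * a - 1)); rewrite mN; congr _%:R; lia.
by apply: cond_C4_shell mN _; rewrite (supported_eq0 supported_harmonic_form4_Sh16) //; lia.
Qed.

End Shells.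

Theorem theorem9p2 (R : realType) :
  (* (i) *)
  (forall (n : nat) (m : R), (2 <= n)%N ->
     (shellZ n m != [::] -> sph_design (shellZ n m) 3) /\
     (shellSh n m != [::] -> sph_design (shellSh n m) 3)) /\
  (* (ii): 3 1/2-designs, i.e. s = 1 *)
  ((forall m : R, shellZ 2 m != [::] -> sph_design_half (shellZ 2 m) 1) /\
   (forall m : R, shellSh 2 m != [::] -> sph_design_half (shellSh 2 m) 1) /\
   (forall a : nat, sph_design_half (shellZ 16 (2 * 4 ^+ a : R)) 1) /\
   (forall a : nat, (1 <= a)%N -> sph_design_half (shellSh 16 (2 * 4 ^+ a : R)) 1) /\
   sph_design_half (shellSh 40 (24 : R)) 1) /\
  (* (iii) *)
  ((forall a : nat, (1 <= a)%N -> sph_design (shellZ 4 (2 * a%:R : R)) 5) /\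
   (forall a b : nat, sph_design (shellZ 7 (4 ^+ a * (8 * b%:R + 3) : R)) 5) /\
   (forall a : nat, (1 <= a)%N -> sph_design (shellSh 16 (4 * a%:R + 2 : R)) 5)).
Proof.
split=> [n m _|]; first by rewrite shellZE shellShE; split; apply: sph_design3_shell.
split; [split; [|split; [|split; [|split]]] | split; [|split]].
- by move=> m; rewrite shellZE; apply: sph_design_half_plane.
- by move=> m; rewrite shellShE; apply: sph_design_half_plane.
- move=> a; rewrite shellZE; apply: (@sph_design_half_shellZ16 _ _ a).
  by rewrite natrM natrX; ring.
- move=> a a1; rewrite shellShE; apply: (sph_design_half_shellSh16 a1).
  by rewrite natrM natrX; ring.
- by rewrite shellShE; apply: sph_design_half_shellSh40; rewrite -natrM.
- move=> a _; rewrite shellZE; apply: (@sph_design5_shellZ4 _ _ a).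
  by rewrite natrM; ring.
- move=> a b; rewrite shellZE; apply: (@sph_design5_shellZ7 _ _ a b).
  by rewrite natrM natrX natrD natrM; ring.
- move=> a a1; rewrite shellShE; apply: (sph_design5_shellSh16 a1).
  by rewrite natrD natrM; ring.
Qed.
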